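(* Let $(M,F)$ be a Finsler manifold endowed with a concurrent $\pi$-vector field $\overline A$. Put $\mathbf B:=i_{\overline A}\,g$ and $\mathfrak B:=\mathbf B(\overline\eta)$. Under the special golden Finsler metric change $\widetilde F=\frac{\mathfrak B^2}{F}-F-\mathfrak B$, the Finsler metrics $F$ and $\widetilde F$ do not share the same set of geodesics. (That is, the unparameterized geodesics of the base metric $F$ and of the golden metric $\widetilde F$ are strictly distinct.)
   Context: $M$ is an $n$-dimensional smooth manifold and $\pi:TM\to M$ its tangent bundle; $\pi$-vector fields (barred) are sections of the pullback bundle $\pi^{-1}(TM)$. $\gamma:\pi^{-1}(TM)\to TTM$ is the natural injection onto the vertical bundle, $\rho:TTM\to\pi^{-1}(TM)$ is the natural projection induced by $d\pi$, $J=\gamma\circ\rho$, $d_Jf=df\circ J$ for functions $f$, $\overline\eta(u)=(u,u)$, and $\mathcal C=\gamma\overline\eta$ is the Liouville vector field. A Finsler metric $F:TM\to[0,\infty)$ is smooth on the slit tangent bundle, continuous on $TM$, homogeneous of degree $1$ in the directional argument $y$, with $\Omega=\frac12dd_JF^2$ of maximal rank; its metric tensor is $g(\rho X,\rho Y)=\Omega(JX,Y)$. If these conditions hold on a conic subset of the slit tangent bundle, the metric is called conic. Let $\nabla$ and $D^\circ$ be the Cartan and Berwald connections of $F$ on $\pi^{-1}(TM)$ and $\beta$ the associated horizontal map (the inverse of $\rho$ restricted to the horizontal bundle). A non-vanishing $\pi$-vector field $\overline A$ is concurrent if, for all $\overline Z$, $\nabla_{\beta\overline Z}\overline A=-\overline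 Z=D^\circ_{\beta\overline Z}\overline A$ and $\nabla_{\gamma\overline Z}\overline A=0=D^\circ_{\gamma\overline Z}\overline A$. Standing assumption: $\widetilde F$ defines a (conic) Finsler metric, and $F^2(1-2A^2)+3\mathfrak B^2\neq0$, where $A^2=g(\overline A,\overline A)$.
   Formalization: The formal theorem assumes dim M ≥ 2; in dimension 1 the claim is false, since any two metrics then share all unparameterized geodesics (e.g. M=(1,∞), F=|y|, A=−x d/dx, golden metric (x²+x−1)y on y>0). *)

(* Defs.v *)
From HB Require Import structures.
From mathcomp Require Import all_boot all_order all_algebra.
From mathcomp Require Import all_classical all_reals all_analysis.
Set Implicit Arguments.
Unset Strict Implicit.
Unset Printing Implicit Defensive.
Import Order.TTheory GRing.Theory Num.Theory.
Import numFieldNormedType.Exports.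
Local Open Scope classical_set_scope.
Local Open Scope ring_scope.

Section Smoothness.
Variables (R : realType) (V W : normedModType R).

(* Meant for open [U] and finite-dimensional [V]; the iterated directional
   derivatives are then the iterated partial derivatives. *)
Fixpoint Ck (k : nat) (U : set V) (f : V -> W) : Prop :=
  match k with
  | 0 => forall x, U x -> f @ x --> f x
  | k'.+1 => (forall x, U x -> differentiable f x) /\
             (forall v : V, Ck k' U (fun x => 'D_v f x))
  end.

Definition smooth_on (U : set V) (f : V -> W) : Prop := forall k, Ck k U f.

End Smoothness.

(* [chart_at p] selects a chart around [p]; it is only used to represent the
   tangent space at [p] (see [TM]). *)
Record manifold (R : realType) (n : nat) := Manifold {
  mpoint :> topologicalType ;
  mhausdorff : hausdorff_space mpoint ;
  msecond_countable : @second_countable mpoint ;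
  chart : Type ;
  dom : chart -> set mpoint ;
  coord : chart -> mpoint -> 'rV[R]_n ;
  param : chart -> 'rV[R]_n -> mpoint ;
  dom_open : forall i, open (dom i) ;
  cod_open : forall i, open (coord i @` dom i) ;
  coordK : forall i p, dom i p -> param i (coord i p) = p ;
  coord_continuous : forall i p, dom i p -> coord i @ p --> coord i p ;
  param_continuous : forall i x, (coord i @` dom i) x ->
    param i @ x --> param i x ;
  transition_smooth : forall i j,
    smooth_on (coord i @` (dom i `&` dom j)) (coord j \o param i) ;
  chart_at : mpoint -> chart ;
  chart_atP : forall p, dom (chart_at p) p }.

Section Bundles.
Variables (R : realType) (n : nat) (M : manifold R n).
Local Notation E := 'rV[R]_n.

Definition cod (i : chart M) : set E := coord i @` dom i.

(* [(p, v)] is the tangent vector at [p] whose components in the chart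
   [chart_at p] are [v]. *)
Definition TM : Type := (mpoint M * E)%type.

(* Components in the chart [j] of the vector at the point of coordinates [x]
   in the chart [i] whose components in the chart [i] are [y]. *)
Definition transfer (i j : chart M) (x y : E) : E :=
  'D_y (coord j \o param i) x.

(* The tangent vector with coordinates [u = (x, y)] in the chart of [TM]
   induced by [i], and conversely. *)
Definition Tparam (i : chart M) (u : E * E) : TM :=
  let p := param i u.1 in (p, transfer i (chart_at p) u.1 u.2).

Definition Tcoord (w : TM) : E * E := (coord (chart_at w.1) w.1, w.2).

Definition slit : set TM := [set w | w.2 != 0].

(* The part of [D] lying over the domain of [i], in coordinates. *)
Definition Tset (i : chart M) (D : set TM) : set (E * E) :=
  [set u | cod i u.1 /\ D (Tparam i u)].

Definition Topen (D : set TM) : Prop := forall i, open (Tset i D).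

Definition local_fun (F : TM -> R) (i : chart M) : E * E -> R :=
  fun u => F (Tparam i u).

Definition Tsmooth (D : set TM) (F : TM -> R) : Prop :=
  forall i, smooth_on (Tset i D) (local_fun F i).

Definition Tcontinuous (F : TM -> R) : Prop :=
  forall i u, cod i u.1 -> local_fun F i @ u --> local_fun F i u.

(* A pi-vector field maps [w], a tangent vector at [p], to a tangent vector at
   [p], again given by its components in [chart_at p]. *)
Definition pi_field : Type := TM -> E.

Definition local_field (A : pi_field) (i : chart M) : E * E -> E :=
  fun u => let c := chart_at (param i u.1) in
    transfer c i (coord c (param i u.1)) (A (Tparam i u)).

Definition pi_smooth (D : set TM) (A : pi_field) : Prop :=
  forall i, smooth_on (Tset i D) (local_field A i).

End Bundles.

(* The geometry of a Finsler function [f] of the coordinates [(x, y)]; a vector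
   tangent to [TM] at [u] is a pair (d/dx components, d/dy components). *)
Section LocalFinsler.
Variables (R : realType) (n : nat).
Local Notation E := 'rV[R]_n.
Variable f : E * E -> R.

Definition gamma (z : E) : E * E := (0, z).
Definition rho (X : E * E) : E := X.1.
Definition J (X : E * E) : E * E := gamma (rho X).

Definition f2 (u : E * E) : R := f u ^+ 2.

Definition dJf2 (Y u : E * E) : R := 'D_(J Y) f2 u.

(* (1/2) d d_J F^2, evaluated on the constant extensions of [X] and [Y]. *)
Definition Omega (u X Y : E * E) : R :=
  2^-1 * ('D_X (dJf2 Y) u - 'D_Y (dJf2 X) u).

Definition Omega_nondegenerate (u : E * E) : Prop :=
  forall X, (forall Y, Omega u X Y = 0) -> X = 0.

(* [(z, 0)] and [(w, 0)] are lifts of [z] and [w] through [rho]. *)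
Definition metric (u : E * E) (z w : E) : R :=
  Omega u (J (z, 0)) (w, 0).

Definition ebase (i : 'I_n) : E := delta_mx 0 i.

Definition metric_mx (u : E * E) : 'M[R]_n :=
  \matrix_(i, j) metric u (ebase i) (ebase j).

(* The vector with components g^{il} b(e_l). *)
Definition sharp (u : E * E) (b : E -> R) : E :=
  (\row_l b (ebase l)) *m invmx (metric_mx u).

(* G^i = (1/4) g^{il} (y^k d^2 F^2 / dx^k dy^l - dF^2 / dx^l); the canonical
   spray is y^i d/dx^i - 2 G^i d/dy^i. *)
Definition spray (u : E * E) : E :=
  4^-1 *: sharp u (fun e =>
    'D_(u.2, 0) (fun u' => 'D_(gamma e) f2 u') u - 'D_(e, 0) f2 u).

(* N^i_j z^j, where N^i_j = dG^i / dy^j. *)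
Definition nonlin (u : E * E) (z : E) : E := 'D_(gamma z) spray u.

(* delta_j = d/dx^j - N^k_j d/dy^k *)
Definition beta (u : E * E) (z : E) : E * E := (z, - nonlin u z).

(* (1/2) g^{il} (delta_j g_{lk} + delta_k g_{lj} - delta_l g_{jk}) z^j w^k *)
Definition cartan_h (u : E * E) (z w : E) : E :=
  2^-1 *: sharp u (fun e =>
    'D_(beta u z) (fun u' => metric u' e w) u
    + 'D_(beta u w) (fun u' => metric u' e z) u
    - 'D_(beta u e) (fun u' => metric u' z w) u).

(* C^i_{jk} z^j w^k, where C_{ljk} = (1/2) d g_{jk} / dy^l. *)
Definition cartan_v (u : E * E) (z w : E) : E :=
  2^-1 *: sharp u (fun e => 'D_(gamma e) (fun u' => metric u' z w) u).

(* (dN^i_j / dy^k) z^j w^k *)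
Definition berwald_h (u : E * E) (z w : E) : E :=
  'D_(gamma w) (fun u' => nonlin u' z) u.

(* The covariant derivatives of the pi-vector field [a] along [beta z] and
   [gamma z], for the Cartan and the Berwald connections. *)
Definition cartan_beta (a : E * E -> E) (u : E * E) (z : E) : E :=
  'D_(beta u z) a u + cartan_h u z (a u).
Definition cartan_gamma (a : E * E -> E) (u : E * E) (z : E) : E :=
  'D_(gamma z) a u + cartan_v u z (a u).
Definition berwald_beta (a : E * E -> E) (u : E * E) (z : E) : E :=
  'D_(beta u z) a u + berwald_h u z (a u).
Definition berwald_gamma (a : E * E -> E) (u : E * E) (z : E) : E :=
  'D_(gamma z) a u.

End LocalFinsler.

Section Finsler.
Variables (R : realType) (n : nat) (M : manifold R n).
Local Notation E := 'rV[R]_n.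
Implicit Types (F : TM M -> R) (D : set (TM M)) (A : pi_field M).

Definition conic_domain D : Prop :=
  [/\ D `<=` @slit R n M, Topen D, D !=set0 &
      forall p v (l : R), 0 < l -> D (p, v) -> D (p, l *: v)].

Definition finsler_conditions D F : Prop :=
  [/\ forall w, D w -> 0 <= F w,
      Tsmooth D F,
      forall p v (l : R), 0 < l -> D (p, v) -> F (p, l *: v) = l * F (p, v) &
      forall i u, Tset i D u -> Omega_nondegenerate (local_fun F i) u].

Definition conic_finsler D F : Prop :=
  conic_domain D /\ finsler_conditions D F.

Definition finsler F : Prop :=
  [/\ finsler_conditions (@slit R n M) F,
      Tcontinuous F,
      forall w, 0 <= F w &
      forall p v (l : R), 0 < l -> F (p, l *: v) = l * F (p, v)].

(* Covariant derivatives are tensorial in the direction, so "for every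
   pi-vector field Z" amounts to every value [z] of Z at every point [u]. *)
Definition concurrent F A : Prop :=
  [/\ pi_smooth (@slit R n M) A,
      forall w, slit w -> A w != 0 &
      forall i u z, Tset i (@slit R n M) u ->
        let f := local_fun F i in
        let a := local_field A i in
        [/\ cartan_beta f a u z = - z,
            berwald_beta f a u z = - z,
            cartan_gamma f a u z = 0 &
            berwald_gamma a u z = 0]].

(* g(Y, Z) at [w], for [Y] and [Z] tangent at the base point of [w]. *)
Definition gT F (w : TM M) (Y Z : E) : R :=
  metric (local_fun F (chart_at w.1)) (Tcoord w) Y Z.

Definition Asq F A (w : TM M) : R := gT F w (A w) (A w).

Definition Bform F A (w : TM M) (Z : E) : R := gT F w (A w) Z.

(* The tautological pi-vector field w |-> (w, w). *)
Definition eta : pi_field M := fun w => w.2.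

Definition Bfrak F A (w : TM M) : R := Bform F A w (eta w).

Definition golden F A (w : TM M) : R :=
  Bfrak F A w ^+ 2 / F w - F w - Bfrak F A w.

Definition open_interval (I : set R) : Prop :=
  [/\ open I, is_interval I & I !=set0].

Definition smooth_curve (I : set R) (c : R -> M) : Prop :=
  (forall t, I t -> c @ t --> c t) /\
  (forall i : chart M, smooth_on (I `&` c @^-1` dom i) (coord i \o c)).

Definition velocity (c : R -> M) (t : R) : TM M :=
  (c t, 'D_1 (coord (chart_at (c t)) \o c) t).

(* The geodesics of [F] with velocity in [D]: the integral curves of the
   spray, x'' + 2 G(x, x') = 0. *)
Definition geodesic F D (I : set R) (c : R -> M) : Prop :=
  [/\ open_interval I,
      smooth_curve I c,
      forall t, I t -> D (velocity c t) &
      forall (i : chart M) t, I t -> dom i (c t) ->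
        let x := coord i \o c in
        'D_1 (fun s => 'D_1 x s) t
        + 2 *: spray (local_fun F i) (x t, 'D_1 x t) = 0].

(* Geodesics up to reparametrization; as a conic metric need not be reversible,
   parameter changes preserve the orientation. *)
Definition unparam_geodesics F D : set (set R * (R -> M)) :=
  [set S | let I := S.1 in let c := S.2 in
    open_interval I /\ smooth_curve I c /\
    exists (I' : set R) (theta : R -> R),
      [/\ open_interval I', smooth_on I' theta,
          forall t, I' t -> 0 < 'D_1 theta t,
          theta @` I' = I &
          geodesic F D I' (c \o theta)]].

End Finsler.

(* Main.v *)
(** Let [B_e = g(A, e)] and let [Bfrak = B_e y^e].  Since [A] does not depend on
    [y] and is annihilated by the Cartan tensor, [B_e] depends on [x] only; the
    equation [nabla_(beta z) A = - z] makes the horizontal derivative of [B]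
    equal to [- g], so the one-form [B] is closed and [Bfrak] has derivative
    [- F^2] along the spray of [F].  Evaluated at the acceleration of an
    [F]-geodesic, the Euler-Lagrange expression of [F] vanishes, and so does that
    of [Bfrak] because [B] is closed; hence the one of the golden metric
    [Bfrak^2 / F - F - Bfrak] reduces to
    [- 2 F B_e + 2 Bfrak dF/dy^e].  The Euler-Lagrange expression of a
    1-homogeneous Lagrangian does not see reparametrizations, so if the geodesics
    agree this vanishes on [D], that is [F^2 A = Bfrak y] there.  Differentiating
    in [y] contradicts [2 <= n].  Geodesics through every vector of [D] exist by
    Picard iteration and the covariance of the Euler-Lagrange expression. *)

Require Import Defs.
From HB Require Import structures.
From mathcomp Require Import all_boot all_order all_algebra.
From mathcomp Require Import all_classical all_reals all_analysis.
From mathcomp Require Import ring lra.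
Set Implicit Arguments.
Unset Strict Implicit.
Unset Printing Implicit Defensive.
Import Order.TTheory GRing.Theory Num.Theory.
Import numFieldNormedType.Exports.
Local Open Scope classical_set_scope.
Local Open Scope ring_scope.

(** * Calculus in finite dimension *)

(** The spray of the golden metric is never computed. Nondegeneracy makes the geodesic equation of
    either metric equivalent to the vanishing of the Euler-Lagrange expression of its square,
    conservation of energy passes from the square to the metric, and the golden metric is a function
    of F and Bfrak alone. In its expression only the derivatives of the coefficients 2 Bfrak / F and
    (Bfrak / F)^2 along the spray survive; they are explicit because F is constant there and Bfrak
    has derivative - F^2. The contradiction is infinitesimal: F^2 A = Bfrak y makes A parallel to y
    on an open set although A does not move with y, so a vertical derivative makes every vector a
    multiple of y. Equality of two sets of curves says something about a vector of D only if a
    geodesic passes through it, hence the existence theorem. Its obstacle is that [geodesic] asks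
    for the equation in every chart meeting the curve, whereas the solution is built in one. *)

(* Instances: [R], row vectors, and products of such spaces. *)
Record fbasis (R : realType) (V : normedModType R) := FBasis {
  fidx : finType;
  fvec : fidx -> V;
  fcoord : fidx -> V -> R;
  fcoord_linear : forall i (c : R) u v,
    fcoord i (c *: u + v) = c * fcoord i u + fcoord i v;
  fcoord_continuous : forall i, continuous (fcoord i);
  fexpand : forall v, v = \sum_i fcoord i v *: fvec i }.

Arguments fvec {R V} _ _.
Arguments fcoord {R V} _ _ _.
Arguments fcoord_linear {R V} _ _.
Arguments fcoord_continuous {R V} _ _.

Lemma fcoordB (R : realType) (V : normedModType R) (b : fbasis V) i u v :
  fcoord b i (u - v) = fcoord b i u - fcoord b i v.
Proof. by rewrite -scaleN1r addrC fcoord_linear mulN1r addrC. Qed.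

Section Derivatives.
Variables (R : realType).
Implicit Types (V W : normedModType R).

(** The first-order expansion of [f] at [x] is also one of [g], and uniqueness of the differential
    identifies it. *)
Lemma near_eq_differentiable V W (f g : V -> W) x :
  (\near x, f x = g x) -> differentiable f x -> differentiable g x.
Proof.
move=> fg df; have fgx : f x = g x by exact: nbhs_singleton fg.
have [cf _] := (diff_locallyP x f).1 df.
have E : g \o shift x = cst (g x) + 'd f x +o_ 0 id.
  apply/eqaddoP => e e0.
  have /eqaddoP/(_ _ e0) := diff_locally df.
  have : \forall h \near 0, f (h + x) = g (h + x).
    have := fg; rewrite (near_shift 0) /= => H.
    near=> h; rewrite -[h + x]/(shift x h).
    by have : f ((h + (x - 0))) = g (h + (x - 0)); [near: h|rewrite subr0].
  apply: filterS2 => h fgh.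
  by rewrite /= !fctE /= fgh fgx.
have dg : 'd g x = 'd f x :> (_ -> _) by apply: diff_unique.
by apply/diff_locallyP; rewrite dg.
Unshelve. all: by end_near. Qed.

Lemma deriveDl V W (f : V -> W) x u v : differentiable f x ->
  'D_(u + v) f x = 'D_u f x + 'D_v f x.
Proof. by move=> df; rewrite !deriveE// linearD. Qed.

Lemma deriveZdir V W (f : V -> W) x (c : R) v : differentiable f x ->
  'D_(c *: v) f x = c *: 'D_v f x.
Proof. by move=> df; rewrite !deriveE// linearZ. Qed.

Lemma derive_sumdir V W (f : V -> W) x (I : finType) (v : I -> V) :
  differentiable f x ->
  'D_(\sum_i v i) f x = \sum_i 'D_(v i) f x.
Proof.
move=> df; rewrite deriveE// linear_sum.
by apply: eq_bigr => i _; rewrite deriveE.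
Qed.

Lemma derive_comp (U : normedModType R) V W (f : U -> V) (g : V -> W) x v :
  differentiable f x -> differentiable g (f x) ->
  'D_v (g \o f) x = 'D_('D_v f x) g (f x).
Proof.
move=> df dg; rewrite !deriveE//; last exact: differentiable_comp.
by rewrite diff_comp.
Qed.

(** [l] is a bare function, so that projections, coordinates and scalings can be passed directly;
    the linear structure is packed inside the proof. *)
Lemma linear_diff V W (l : V -> W) x :
  (forall (c : R) u v, l (c *: u + v) = c *: l u + l v) -> continuous l ->
  differentiable l x /\ forall v, 'D_v l x = l v.
Proof.
move=> ll cl.
pose lM := GRing.isLinear.Build R V W *:%R l ll.
pose L : {linear V -> W} := HB.pack l lM.
have dl : differentiable l x by apply: (@linear_differentiable _ _ _ L).
by split=> // v; rewrite deriveE// (@diff_lin _ _ _ L).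
Qed.

Lemma differentiable_linear_comp (U : normedModType R) V W (f : U -> V)
    (l : V -> W) x :
  (forall (c : R) u v, l (c *: u + v) = c *: l u + l v) -> continuous l ->
  differentiable f x -> differentiable (fun y => l (f y)) x.
Proof.
move=> ll cl df; apply: (@differentiable_comp _ _ _ _ f l x df).
exact: (linear_diff _ ll cl).1.
Qed.

Lemma derive_linear_comp (U : normedModType R) V W (f : U -> V)
    (l : V -> W) x v :
  (forall (c : R) u v, l (c *: u + v) = c *: l u + l v) -> continuous l ->
  differentiable f x ->
  'D_v (fun y => l (f y)) x = l ('D_v f x).
Proof.
move=> ll cl df; have [dl Dl] := linear_diff (f x) ll cl.
by rewrite (@derive_comp _ _ _ f l)// Dl.
Qed.

Lemma bigsum_diff V W (I : finType) (f : I -> V -> W) x :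
  (forall i, differentiable (f i) x) ->
  differentiable (fun y => \sum_i f i y) x /\
  forall v, 'D_v (fun y => \sum_i f i y) x = \sum_i 'D_v (f i) x.
Proof.
move=> df; elim: (index_enum I) => [|i s [ds Ds]].
  under eq_fun do rewrite big_nil.
  split=> [|v]; first exact: (@differentiable_cst _ _ _ 0).
  by rewrite big_nil (@derive_cst _ _ _ 0).
under eq_fun do rewrite big_cons.
split=> [|v]; first exact: (@differentiableD _ _ _ (f i)).
by rewrite big_cons -Ds (@deriveD _ _ _ (f i))//; exact: diff_derivable.
Qed.

End Derivatives.

(** * Closure properties of the classes C^k and the chain rule *)

Section Ck.
Variables (R : realType).
Implicit Types (V W : normedModType R).

Lemma Ck_sub V W k (U U' : set V) (f : V -> W) :
  U' `<=` U -> Ck k U f -> Ck k U' f.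
Proof.
move=> UU; elim: k f => [|k IH] f /=; first by move=> Hf x /UU /Hf.
by case=> H1 H2; split=> [x /UU /H1//|v]; exact: IH.
Qed.

(** Openness turns equality on [U] into equality near each point, which derivatives respect. In the
    closure lemmas below this replaces the derivative of a compound expression by its explicit
    formula. *)
Lemma Ck_eq V W k (U : set V) (f g : V -> W) : open U ->
  (forall x, U x -> f x = g x) -> Ck k U f -> Ck k U g.
Proof.
move=> oU; elim: k f g => [|k IH] f g fg /=.
  move=> H x Ux; rewrite -(fg _ Ux).
  apply: cvg_trans (H x Ux); apply: near_eq_cvg.
  have : nbhs x U by exact: open_nbhs_nbhs.
  by apply: filterS => y /fg.
case=> H1 H2; have nfg x : U x -> \near x, f x = g x.
  move=> Ux; have : nbhs x U by exact: open_nbhs_nbhs.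
  by apply: filterS => y /fg.
split=> [x Ux|v]; first exact: near_eq_differentiable (nfg x Ux) (H1 x Ux).
by apply: IH (H2 v) => x Ux; exact: near_eq_derive (nfg x Ux).
Qed.

Lemma Ck_continuous V W k (U : set V) (f : V -> W) x :
  Ck k U f -> U x -> {for x, continuous f}.
Proof.
case: k => [|k] /=; first by move=> H /H.
by case=> H _ /H; exact: differentiable_continuous.
Qed.

Lemma Ck_W V W k (U : set V) (f : V -> W) : Ck k.+1 U f -> Ck k U f.
Proof.
elim: k f => [|k IH] f; first by move=> Hf x Ux; exact: Ck_continuous Hf Ux.
by case=> H1 H2; split=> // v; exact/IH/H2.
Qed.

Lemma Ck_cst V W k (U : set V) (c : W) : Ck k U (fun=> c).
Proof.
elim: k c => [|k IH] c /=; first by move=> x _; exact: cvg_cst.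
split=> [x _|v]; first exact: (@differentiable_cst _ _ _ c).
have -> : (fun x => 'D_v (fun=> c) x) = (fun=> 0).
  by apply/funext => x; exact: (@derive_cst _ _ _ c).
exact: IH.
Qed.

Lemma CkD V W k (U : set V) (f g : V -> W) : open U ->
  Ck k U f -> Ck k U g -> Ck k U (fun x => f x + g x).
Proof.
move=> oU; elim: k f g => [|k IH] f g /=.
  by move=> Hf Hg x Ux; apply: cvgD; [exact: Hf|exact: Hg].
move=> [f1 f2] [g1 g2]; split=> [x Ux|v].
  exact: (@differentiableD _ _ _ f g x (f1 _ Ux) (g1 _ Ux)).
apply: (@Ck_eq _ _ _ _ (fun x => 'D_v f x + 'D_v g x)) => //; last exact: IH.
move=> x Ux; rewrite (@deriveD _ _ _ f g)//; apply: diff_derivable;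
  [exact: f1|exact: g1].
Qed.

Lemma Ck_bigsum V W k (U : set V) (I : finType) (f : I -> V -> W) : open U ->
  (forall i, Ck k U (f i)) -> Ck k U (fun x => \sum_i f i x).
Proof.
move=> oU Hf; elim: (index_enum I) => [|i s IH].
  by under eq_fun do rewrite big_nil; exact: Ck_cst.
by under eq_fun do rewrite big_cons; exact: CkD.
Qed.

Lemma Ck_linear_comp V W W' k (U : set V) (f : V -> W) (l : W -> W') : open U ->
  (forall (c : R) u v, l (c *: u + v) = c *: l u + l v) -> continuous l ->
  Ck k U f -> Ck k U (fun x => l (f x)).
Proof.
move=> oU ll cl; elim: k f => [|k IH] f /=.
  by move=> Hf x Ux; apply: (@continuous_comp _ _ _ f l); [exact: Hf|exact: cl].
move=> [f1 f2]; split=> [x Ux|v].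
  exact: differentiable_linear_comp (f1 _ Ux).
apply: Ck_eq oU _ (IH _ (f2 v)) => x Ux.
exact/esym/(derive_linear_comp _ ll cl (f1 _ Ux)).
Qed.

Lemma Ck_id V k (U : set V) : Ck k U (fun x => x).
Proof.
case: k => [|k] /=; first by move=> x _; exact: cvg_id.
split=> [x _|v]; first exact: ex_diff.
have -> : (fun x => 'D_v (fun y => y) x) = (fun=> v).
  by apply/funext => x; exact: (@derive_id _ _ x v).
exact: Ck_cst.
Qed.

Lemma Ck_linear V W k (U : set V) (l : V -> W) : open U ->
  (forall (c : R) u v, l (c *: u + v) = c *: l u + l v) -> continuous l ->
  Ck k U l.
Proof. by move=> oU ll cl; exact: (Ck_linear_comp oU ll cl (Ck_id _ _)). Qed.

Lemma CkZl V W k (U : set V) (f : V -> R) (w : W) : open U ->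
  Ck k U f -> Ck k U (fun x => f x *: w).
Proof.
move=> oU; apply: (Ck_linear_comp (l := fun c : R => c *: w)) => //.
- by move=> c u v; rewrite scalerDl scalerA.
- exact: scalel_continuous.
Qed.

Lemma CkZ V W k (U : set V) (f : V -> W) (c : R) : open U ->
  Ck k U f -> Ck k U (fun x => c *: f x).
Proof.
move=> oU; apply: (Ck_linear_comp (l := fun w : W => c *: w)) => //.
- by move=> d u v; rewrite scalerDr !scalerA mulrC.
- exact: scaler_continuous.
Qed.

Lemma CkM V k (U : set V) (f g : V -> R) : open U ->
  Ck k U f -> Ck k U g -> Ck k U (fun x => f x * g x).
Proof.
move=> oU; elim: k f g => [|k IH] f g.
  by move=> Hf Hg x Ux; apply: cvgM; [exact: Hf|exact: Hg].
move=> Cf Cg; have Cf' := Ck_W Cf; have Cg' := Ck_W Cg.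
move: Cf Cg => [f1 f2] [g1 g2]; split=> [x Ux|v].
  exact: (@differentiableM _ _ f g x (f1 _ Ux) (g1 _ Ux)).
apply: (@Ck_eq _ _ _ _ (fun x => f x * 'D_v g x + g x * 'D_v f x)) => //.
  move=> x Ux; rewrite (@deriveM _ _ f g)//; apply: diff_derivable;
  [exact: f1|exact: g1].
apply: CkD => //; first exact: IH Cf' (g2 v).
exact: IH Cg' (f2 v).
Qed.

(** The derivative - f^-2 f' involves f^-1 itself, which is one class lower by the induction
    hypothesis. *)
Lemma CkV V k (U : set V) (f : V -> R) : open U -> (forall x, U x -> f x != 0) ->
  Ck k U f -> Ck k U (fun x => (f x)^-1).
Proof.
move=> oU f0; elim: k => [|k IH].
  by move=> Hf x Ux; apply: cvgV; [exact: f0|exact: Hf].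
move=> Cf; have Cf' := Ck_W Cf.
move: Cf => [f1 f2]; split=> [x Ux|v].
  exact: (@differentiableV _ _ f x (f1 _ Ux) (f0 _ Ux)).
apply: (@Ck_eq _ _ _ _ (fun x => (-1) * ((f x)^-1 * (f x)^-1) * 'D_v f x)) => //.
  move=> x Ux; rewrite (@deriveV _ _ f)//; last exact/diff_derivable/f1.
    by rewrite mulN1r -expr2 -exprVn.
  exact: f0.
apply: CkM => //; last exact: f2.
apply: CkM => //; first exact: Ck_cst.
by apply: CkM => //; exact: IH.
Qed.

Lemma Ck_coords V W (bW : fbasis W) k (U : set V) (f : V -> W) : open U ->
  (forall i, Ck k U (fun x => fcoord bW i (f x))) -> Ck k U f.
Proof.
move=> oU H; rewrite (_ : f = fun x => \sum_i fcoord bW i (f x) *: fvec bW i).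
  by apply: Ck_bigsum => // i; exact: CkZl.
by apply/funext => x; rewrite -fexpand.
Qed.

Lemma Ck_coord V W (bW : fbasis W) k (U : set V) (f : V -> W) i : open U ->
  Ck k U f -> Ck k U (fun x => fcoord bW i (f x)).
Proof.
move=> oU; apply: (Ck_linear_comp (l := fcoord bW i)) => //.
  exact: fcoord_linear.
exact: fcoord_continuous.
Qed.

(** In the chain rule the direction ['D_v f x] moves with [x], while [Ck] speaks of fixed
    directions. Expanding it in a basis gives a finite sum of products to which the induction
    hypothesis applies. *)
Lemma Ck_comp_scalar V V' (bV : fbasis V') k (U : set V) (U' : set V')
    (f : V -> V') (g : V' -> R) : open U -> open U' ->
  (forall x, U x -> U' (f x)) ->
  Ck k U f -> Ck k U' g -> Ck k U (fun x => g (f x)).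
Proof.
move=> oU oU' fU; elim: k g => [|k IH] g.
  move=> Hf Hg x Ux; apply: (@continuous_comp _ _ _ f g); first exact: Hf.
  exact/Hg/fU.
move=> Cf; have Cf' := Ck_W Cf.
move: Cf => [f1 f2] [g1 g2]; split=> [x Ux|v].
  apply: (@differentiable_comp _ _ _ _ f g); [exact: f1|exact/g1/fU].
apply: (@Ck_eq _ _ _ _ (fun x =>
  \sum_i fcoord bV i ('D_v f x) * 'D_(fvec bV i) g (f x))) => //.
  move=> x Ux; rewrite (@derive_comp _ _ _ _ f g);
    [|exact: f1|exact/g1/fU].
  have dg : differentiable g (f x) by exact/g1/fU.
  rewrite [in RHS](fexpand bV ('D_v f x)) derive_sumdir//.
  by apply: eq_bigr => i _; rewrite deriveZdir.
apply: Ck_bigsum => // i; apply: CkM => //.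
  exact: Ck_coord oU (f2 v).
exact: IH Cf' (g2 _).
Qed.

Lemma Ck_comp V V' W (bV : fbasis V') (bW : fbasis W) k (U : set V)
    (U' : set V') (f : V -> V') (g : V' -> W) : open U -> open U' ->
  (forall x, U x -> U' (f x)) ->
  Ck k U f -> Ck k U' g -> Ck k U (fun x => g (f x)).
Proof.
move=> oU oU' fU Cf Cg; apply: (Ck_coords (bW := bW)) => // i.
apply: (Ck_comp_scalar (g := fun y => fcoord bW i (g y)) bV oU oU' fU Cf).
exact: Ck_coord.
Qed.

End Ck.

Section Instances.
Variables (R : realType).

Lemma fbasis_real : fbasis R.
Proof.
apply: (@FBasis R R unit (fun=> 1) (fun _ x => x)) => //.
- by move=> _ x; exact: cvg_id.
- by move=> v; rewrite big_const card_unit /= addr0 /GRing.scale /= mulr1.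
Qed.

Lemma fbasis_rV n : fbasis 'rV[R]_n.
Proof.
apply: (@FBasis R _ 'I_n (fun i => delta_mx 0 i) (fun i x => x 0 i)).
- by move=> i c u v; rewrite !mxE.
- by move=> i; exact: coord_continuous.
- exact: row_sum_delta.
Qed.

Lemma fbasis_prod (V W : normedModType R) :
  fbasis V -> fbasis W -> fbasis (V * W)%type.
Proof.
move=> bV bW.
apply: (@FBasis R _ (fidx bV + fidx bW)%type
  (fun i => match i with inl i => (fvec bV i, 0) | inr i => (0, fvec bW i) end)
  (fun i x => match i with inl i => fcoord bV i x.1 | inr i => fcoord bW i x.2 end)).
- by move=> [i|i] c u v /=; rewrite fcoord_linear.
- move=> [i|i] x.
    apply: (@continuous_comp _ _ _ fst (fcoord bV i)); first exact: cvg_fst.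
    exact: fcoord_continuous.
  apply: (@continuous_comp _ _ _ snd (fcoord bW i)); first exact: cvg_snd.
  exact: fcoord_continuous.
- move=> [v w]; rewrite big_sumType /=.
  rewrite {1}(fexpand bV v) {1}(fexpand bW w).
  have H1 (I : finType) (F : I -> V) :
      \sum_i ((F i, 0) : V * W) = (\sum_i F i, 0).
    apply/esym/(big_morph (fun v => (v, 0) : V * W)) => // a b.
    by rewrite -[RHS]/(_ + _, _ + _) addr0.
  have H2 (I : finType) (F : I -> W) :
      \sum_i ((0, F i) : V * W) = (0, \sum_i F i).
    apply/esym/(big_morph (fun v => (0, v) : V * W)) => // a b.
    by rewrite -[RHS]/(_ + _, _ + _) addr0.
  transitivity ((\sum_i fcoord bV i v *: fvec bV i, 0 : W) +
                (0 : V, \sum_i fcoord bW i w *: fvec bW i)).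
    by rewrite -[RHS]/(_ + _, _ + _) addr0 add0r.
  rewrite -H1 -H2; congr (_ + _); apply: eq_bigr => i _.
    by rewrite -[RHS]/(_ *: _, _ *: _) scaler0.
  by rewrite -[RHS]/(_ *: _, _ *: _) scaler0.
Qed.

End Instances.

(** * Symmetry of second derivatives *)

Section Schwarz.
Variables (R : realType) (V : normedModType R).
Implicit Types (f : V -> R) (x v w : V).

Lemma affine_diff x v (s : R) :
  differentiable (fun t : R => x + t *: v) s /\
  'D_1 (fun t : R => x + t *: v) s = v.
Proof.
have [dl Dl] : differentiable (fun t : R => t *: v) s /\
   forall u, 'D_u (fun t : R => t *: v) s = u *: v.
  apply: (linear_diff (l := fun t : R => t *: v)) => [c a b|].
    by rewrite scalerDl scalerA.
  exact: scalel_continuous.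
split.
  by apply: (@differentiableD _ _ _ (cst x)) => //; exact: differentiable_cst.
rewrite (@deriveD _ _ _ (cst x)) //; last exact: diff_derivable.
by rewrite derive_cst add0r Dl scale1r.
Qed.

Lemma line_diff (W : normedModType R) (f : V -> W) x v (s : R) :
  differentiable f (x + s *: v) ->
  differentiable (fun t : R => f (x + t *: v)) s /\
  'D_1 (fun t : R => f (x + t *: v)) s = 'D_v f (x + s *: v).
Proof.
have [da Da] := affine_diff x v s => df; split.
  exact: (@differentiable_comp _ _ _ _ (fun t : R => x + t *: v) f).
by rewrite (@derive_comp _ _ _ _ (fun t : R => x + t *: v) f)// Da.
Qed.

Lemma shift_diff (W : normedModType R) (f : V -> W) x c :
  differentiable f (x + c) ->
  differentiable (fun y => f (y + c)) x /\
  forall v, 'D_v (fun y => f (y + c)) x = 'D_v f (x + c).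
Proof.
have dc : differentiable (fun y => y + c) x.
  by apply: (@differentiableD _ _ _ id (cst c)) => //; exact: differentiable_cst.
move=> df; split; first exact: (@differentiable_comp _ _ _ _ (fun y => y + c) f).
move=> v; rewrite (@derive_comp _ _ _ _ (fun y => y + c) f)//.
rewrite (@deriveD _ _ _ id (cst c));
  [|exact: derivable_id|exact: derivable_cst].
by rewrite derive_cst derive_id addr0.
Qed.

Lemma MVT_line f x v (h : R) : 0 <= h ->
  (forall s, 0 <= s <= h -> differentiable f (x + s *: v)) ->
  exists s, 0 <= s <= h /\ f (x + h *: v) - f x = h * 'D_v f (x + s *: v).
Proof.
move=> h0 df.
have H s : 0 <= s <= h -> is_derive s 1 (fun t => f (x + t *: v)) ('D_v f (x + s *: v)).
  move=> /df /line_diff [d1 d2]; apply: DeriveDef => //; exact: diff_derivable.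
have [||s sh E] := @MVT_segment R (fun t => f (x + t *: v))
  (fun s => 'D_v f (x + s *: v)) 0 h h0.
- by move=> s sh; apply: H; rewrite !(itvP sh).
- apply: derivable_within_continuous => s sh.
  by apply: ex_derive; apply: H; rewrite !(itvP sh).
- exists s; split; first by rewrite !(itvP sh).
  by move: E; rewrite scale0r addr0 subr0 mulrC.
Qed.

(** Two applications of the mean value theorem: along [v] to y |-> f (y + h w) - f y, then along [w]
    to the derivative of [f] in the direction [v]. *)
Lemma second_difference (U : set V) f x v w (h : R) : Ck 2 U f -> 0 <= h ->
  (forall s t, 0 <= s <= h -> 0 <= t <= h -> U (x + s *: v + t *: w)) ->
  exists s t, [/\ 0 <= s <= h, 0 <= t <= h &
    f (x + h *: v + h *: w) - f (x + h *: v) - (f (x + h *: w) - f x) =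
    h * (h * 'D_w (fun y => 'D_v f y) (x + s *: v + t *: w))].
Proof.
move=> [df d2f] h0 HU; have [d1f _] := d2f v.
have hh : 0 <= h <= h by rewrite h0 lexx.
have h00 : 0 <= (0 : R) <= h by rewrite h0 lexx.
pose g y := f (y + h *: w) - f y.
have dg s : 0 <= s <= h -> differentiable g (x + s *: v) /\
    'D_v g (x + s *: v) = 'D_v f (x + s *: v + h *: w) - 'D_v f (x + s *: v).
  move=> sh; have [d1 D1] := shift_diff (df _ (HU s h sh hh)).
  have d2 : differentiable f (x + s *: v).
    by have := df _ (HU s 0 sh h00); rewrite scale0r addr0.
  split; first exact: (@differentiableB _ _ _ (fun y => f (y + h *: w)) f).
  rewrite (@deriveB _ _ _ (fun y => f (y + h *: w)) f) ?D1//; exact: diff_derivable.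
have [s [sh Es]] := MVT_line h0 (fun s sh => (dg s sh).1).
have [t [th Et]] : exists t, 0 <= t <= h /\
    'D_v f (x + s *: v + h *: w) - 'D_v f (x + s *: v) =
    h * 'D_w (fun y => 'D_v f y) (x + s *: v + t *: w).
  by apply: (MVT_line (f := fun y => 'D_v f y) h0) => t th; exact/d1f/HU.
by exists s, t; split=> //; rewrite -Et -(dg _ sh).2 -Es /g.
Qed.

(** The second difference is symmetric in [v] and [w], so it equals h^2 times a value of either
    mixed derivative near [x]; continuity puts these values within [e / 2] of those at [x]. *)
Lemma Schwarz_scalar (U : set V) f x v w : open U -> U x -> Ck 2 U f ->
  'D_v (fun y => 'D_w f y) x = 'D_w (fun y => 'D_v f y) x.
Proof.
move=> oU Ux Cf.
pose A : R := 'D_v (fun y => 'D_w f y) x; pose B : R := 'D_w (fun y => 'D_v f y) x.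
suff : A = B by [].
apply/eqP; rewrite -subr_eq0 -normr_le0; apply/ler_addgt0Pl => e e0; rewrite addr0.
have e2 : 0 < e / 2 by rewrite divr_gt0.
have [_ Cfv] := Cf; have cB := (Cfv v).2 w _ Ux.
have cA := (Cfv w).2 v _ Ux.
have : \forall y \near x, [/\ U y, `|A - 'D_v (fun y => 'D_w f y) y| < e / 2 &
                              `|B - 'D_w (fun y => 'D_v f y) y| < e / 2].
  have NA : \forall y \near x, `|A - 'D_v (fun y => 'D_w f y) y| < e / 2.
    by move/cvgrPdist_lt : cA => /(_ _ e2).
  have NB : \forall y \near x, `|B - 'D_w (fun y => 'D_v f y) y| < e / 2.
    by move/cvgrPdist_lt : cB => /(_ _ e2).
  have NU : nbhs x U by exact: open_nbhs_nbhs.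
  by move: NU NA NB; apply: filterS3 => y.
move=> /nbhs_ballP[d /= d0 Hd].
have [h h0 Hball] : exists2 h : R, 0 < h & forall s t,
    0 <= s <= h -> 0 <= t <= h -> ball x d (x + s *: v + t *: w).
  have n0 : 0 < `|v| + `|w| + 1 by rewrite ltr_wpDl// addr_ge0.
  (* The summand 1 keeps the denominator positive when [v] and [w] vanish. *)
  pose h := d / (`|v| + `|w| + 1) / 2.
  have h0 : 0 < h by rewrite !divr_gt0.
  exists h => // s t /andP[s0 sh] /andP[t0 th].
  rewrite -ball_normE /= opprD addrA opprD addrA subrr add0r -opprD normrN.
  apply: (@le_lt_trans _ _ (h * `|v| + h * `|w|)).
    apply: le_trans (ler_normD _ _) _; rewrite !normrZ !ger0_norm//.
    by apply: lerD; apply: ler_wpM2r.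
  apply: (@lt_trans _ _ (h * (`|v| + `|w| + 1))).
    by rewrite -mulrDr ltr_pM2l// ltrDl.
  by rewrite /h mulrAC divfK ?gt_eqF// ltr_pdivrMr// ltr_pMr// ltr1n.
have HU s t : 0 <= s <= h -> 0 <= t <= h -> U (x + s *: v + t *: w).
  by move=> sh th; have [] := Hd _ (Hball _ _ sh th).
have HU' s t : 0 <= s <= h -> 0 <= t <= h -> U (x + s *: w + t *: v).
  by move=> sh th; rewrite addrAC; exact: HU.
have [s [t [sh th E]]] := second_difference Cf (ltW h0) HU.
have [s' [t' [sh' th' E']]] := second_difference Cf (ltW h0) HU'.
have hn0 : h != 0 by rewrite gt_eqF.
pose C1 : R := 'D_w (fun y => 'D_v f y) (x + s *: v + t *: w).
pose C2 : R := 'D_v (fun y => 'D_w f y) (x + s' *: w + t' *: v).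
(* Both sides are the same second difference, with the roles of [v] and [w] exchanged. *)
have E2 : h * (h * C1) = h * (h * C2).
  transitivity (f (x + h *: v + h *: w) - f (x + h *: v) - (f (x + h *: w) - f x)).
    exact/esym/E.
  transitivity (f (x + h *: w + h *: v) - f (x + h *: w) - (f (x + h *: v) - f x)).
    by rewrite [x + h *: w + _]addrAC !opprB addrACA [RHS]addrACA [_ + f x]addrC
      [- f _ + _]addrC.
  exact: E'.
have [_ _ HB] := Hd _ (Hball _ _ sh th).
have [_ HA _] := Hd _ (Hball _ _ th' sh').
rewrite [x + _ + _]addrAC in HA.
rewrite -/C1 in HB; rewrite -/C2 in HA.
have C12 : C1 = C2 := mulfI hn0 (mulfI hn0 E2).
rewrite C12 in HB; move: C2 HA HB {E2 C12} => C HA HB.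
clear - HA HB; clearbody A B.
rewrite (_ : A - B = (A - C) - (B - C)); last by rewrite opprB addrA subrK.
apply: (le_trans (ler_normB _ _)); rewrite [leRHS](splitr e).
exact: lerD (ltW HA) (ltW HB).
Qed.

Lemma Schwarz (W : normedModType R) (bW : fbasis W) (U : set V) (f : V -> W) x v w :
  open U -> U x -> Ck 2 U f ->
  'D_v (fun y => 'D_w f y) x = 'D_w (fun y => 'D_v f y) x.
Proof.
move=> oU Ux Cf.
have H a b : fcoord bW ^~ ('D_a (fun y => 'D_b f y) x) =1
    (fun i => 'D_a (fun y => 'D_b (fun z => fcoord bW i (f z)) y) x).
  move=> i; have cl := fcoord_linear bW i; have cc := fcoord_continuous bW i.
  have := derive_linear_comp a cl cc ((Cf.2 b).1 _ Ux).
  move=> /esym ->; apply: near_eq_derive.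
  have : nbhs x U by exact: open_nbhs_nbhs.
  apply: filterS => y Uy; apply/esym.
  exact: (derive_linear_comp b cl cc (Cf.1 _ Uy)).
have E i : fcoord bW i ('D_v (fun y => 'D_w f y) x) =
    fcoord bW i ('D_w (fun y => 'D_v f y) x).
  apply: etrans (H v w i) _; apply: etrans (esym (H w v i)).
  by apply: (Schwarz_scalar _ _ oU Ux); exact: Ck_coord.
rewrite [LHS](fexpand bW) [RHS](fexpand bW).
by apply: eq_bigr => i _; rewrite E.
Qed.

End Schwarz.

(** * Local existence for ordinary differential equations *)

Section MeanValue.
Variables (R : realType) (V : normedModType R) (bV : fbasis V).

Lemma fcoord_bounded :
  exists2 M : R, 0 < M & forall i v, `|fcoord bV i v| <= M * `|v|.
Proof.
have H i : exists M : R, 0 <= M /\ forall v, `|fcoord bV i v| <= M * `|v|.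
  pose lM := GRing.isLinear.Build R V R *:%R _ (fcoord_linear bV i).
  pose L : {linear V -> R} := HB.pack (fcoord bV i) lM.
  have /linear_boundedP : bounded_near L (nbhs 0).
    by apply/linear_bounded_continuous; exact: fcoord_continuous.
  move=> [M [Mr HM]]; exists (Num.max 0 M + 1); split=> [|v].
    by rewrite addr_ge0// le_max lexx.
  apply: HM; rewrite ltr_pwDr// le_max lexx orbT //.
have [M HM] := choice H.
exists (\sum_i M i + 1) => [|i v].
  by rewrite ltr_wpDl// sumr_ge0// => i _; have [] := HM i.
apply: le_trans ((HM i).2 v) _; apply: ler_wpM2r => //.
rewrite (bigD1 i)//= -addrA lerDl addr_ge0// sumr_ge0// => j _.
by have [] := HM j.
Qed.

(** The mean value theorem holds coordinate by coordinate, each with its own intermediate point; the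
    constant [C] is the price and depends on the basis alone. *)
Lemma mean_value_bound : exists2 C : R, 0 < C &
  forall (H h : R -> V) (t K : R),
    (forall s : R, `|s| <= `|t| -> is_derive s 1 H (h s)) ->
    (forall s : R, `|s| <= `|t| -> `|h s| <= K) ->
    `|H t - H 0| <= C * (K * `|t|).
Proof.
have [M M0 HM] := fcoord_bounded.
exists (\sum_i M * `|fvec bV i| + 1) => [|H h t K dH hK].
  by rewrite ltr_wpDl// sumr_ge0// => i _; rewrite mulr_ge0// ltW.
have K0 : 0 <= K by apply: le_trans (hK 0 _); rewrite ?normr0.
apply: (@le_trans _ _ ((\sum_i M * `|fvec bV i|) * (K * `|t|))); last first.
  by apply: ler_wpM2r; rewrite ?mulr_ge0// lerDl.
rewrite {1}(fexpand bV (H t - H 0)) mulr_suml.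
apply: le_trans (ler_norm_sum _ _ _) _; apply: ler_sum => i _.
rewrite normrZ [leRHS]mulrAC; apply: ler_wpM2r => //.
have ci := fcoord_linear bV i; have cc := fcoord_continuous bV i.
have dHi s : `|s| <= `|t| -> differentiable (fun s => fcoord bV i (H s)) s /\
    'D_1 (fun s => fcoord bV i (H s)) s = fcoord bV i (h s).
  move=> st; have [d1 d2] := dH s st.
  have d3 : differentiable H s by apply/derivable1_diffP.
  split; first exact: (differentiable_linear_comp ci).
  by rewrite (derive_linear_comp _ ci)// d2.
have st s : 0 <= s <= 1 -> `|0 + s *: t| <= `|t|.
  move=> /andP[s0 s1]; rewrite add0r normrZ ger0_norm//.
  by rewrite ler_piMl.
(* Running from 0 to [t] as 0 + s t with s in [0, 1] treats both signs of [t] at once. *)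
have [s [s01]] := @MVT_line R R (fun s => fcoord bV i (H s)) 0 t 1 ler01
  (fun s s01 => (dHi _ (st s s01)).1).
rewrite add0r scale1r mul1r => E.
rewrite fcoordB E -[X in 'D_X _ _](mulr1 t) -[t * 1]/(t *: (1 : R)) deriveZdir; last first.
  by have [] := dHi _ (st s s01).
rewrite (dHi _ (st s s01)).2 /GRing.scale /= normrM mulrC mulrA.
apply: ler_wpM2r => //; apply: le_trans (HM _ _) _.
by apply: ler_wpM2l; [exact: ltW|exact/hK/st].
Qed.

Lemma C1_locally_Lipschitz (U : set V) (X : V -> V) u0 :
    open U -> U u0 -> Ck 1 U X ->
  exists r L : R, [/\ 0 < r, 0 < L, ball u0 r `<=` U &
    forall u v, ball u0 r u -> ball u0 r v -> `|X u - X v| <= L * `|u - v|].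
Proof.
move=> oU Uu0 [dX cX].
have [C C0 HC] := mean_value_bound.
have [M M0 HM] := fcoord_bounded.
pose B i : R := `|'D_(fvec bV i) X u0| + 1.
have nB : \forall u \near u0, forall i, `|'D_(fvec bV i) X u| <= B i.
  apply: filter_forall => i.
  have := @cvgr_norm_le _ _ _ _ (nbhs_filter u0) _ _ (cX (fvec bV i) _ Uu0) (B i).
  by apply; rewrite /B ltrDl.
have nU : nbhs u0 U by exact: open_nbhs_nbhs.
have : \forall u \near u0, U u /\ forall i, `|'D_(fvec bV i) X u| <= B i.
  by move: nU nB; apply: filterS2 => u.
move=> /nbhs_ballP[d /= d0 Hd].
have d3 : 0 < d / 3 by rewrite divr_gt0.
have B0 i : 0 <= B i by rewrite addr_ge0.
have S0 : 0 <= \sum_i B i by apply: sumr_ge0.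
(* [mean_value_bound] asks for a derivative at all |s| <= 1, so the segment from [v] to [u] is
   prolonged to its reflection through [v]; radius [d / 3] keeps all of it in the ball of radius
   [d]. *)
exists (d / 3), (C * (M * \sum_i B i) + 1); split => //.
- rewrite ltr_wpDl//; apply: mulr_ge0; first exact: ltW.
  by apply: mulr_ge0; first exact: ltW.
- move=> u Hu; apply: (Hd _ _).1; apply: le_ball Hu.
  by rewrite ler_pdivrMr// ler_pMr// ler1n.
move=> u v; rewrite -ball_normE /= => Hu Hv.
have path (s : R) : `|s| <= 1 -> ball u0 d (v + s *: (u - v)).
  move=> s1; rewrite -ball_normE /= opprD addrA.
  apply: le_lt_trans (ler_normB _ _) _.
  have Huv : `|u - v| < d / 3 + d / 3.
    rewrite -(subrKA u0); apply: le_lt_trans (ler_normD _ _) _.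
    by rewrite ltrD// distrC.
  have : `|s *: (u - v)| < d / 3 + d / 3.
    apply: le_lt_trans Huv; rewrite normrZ ler_piMl//.
  move=> H; apply: lt_le_trans (ltrD Hv H) _; lra.
have := HC (fun s => X (v + s *: (u - v))) (fun s => 'D_(u - v) X (v + s *: (u - v)))
  1 (M * (\sum_i B i) * `|u - v|).
rewrite !normr1 scale0r addr0 scale1r subrKC mulr1 => H.
apply: le_trans (H _ _) _.
- move=> s s1; have [Us _] := Hd _ (path s s1).
  have [d1 d2] := line_diff (dX _ Us).
  by apply: DeriveDef => //; exact: diff_derivable.
- move=> s s1; have [Us Bs] := Hd _ (path s s1).
  have -> : 'D_(u - v) X (v + s *: (u - v)) =
      \sum_i fcoord bV i (u - v) *: 'D_(fvec bV i) X (v + s *: (u - v)).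
    rewrite [X in 'D_X _ _](fexpand bV (u - v)) derive_sumdir; last exact: dX.
    by apply: eq_bigr => i _; rewrite deriveZdir//; exact: dX.
  apply: le_trans (ler_norm_sum _ _ _) _.
  rewrite mulrAC mulr_sumr; apply: ler_sum => i _.
  by rewrite normrZ; apply: ler_pM.
- by rewrite mulrA; apply: ler_wpM2r => //; rewrite lerDl.
Qed.

End MeanValue.

(** * Primitives and limits of iterates *)

Section Picard.
Variables (R : realType).

(** The integral starts at -1 so that 0 is interior and the primitive is differentiable on both
    sides of it. *)
Lemma primitive_real (h : R -> R) : continuous h -> exists H : R -> R,
  H 0 = 0 /\ forall t : R, -1 < t < 1 -> is_derive t 1 H (h t).
Proof.
move=> ch.
pose F (x : R) : R := (\int[lebesgue_measure]_(t in `[(-1), x]) h t)%R.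
exists (fun t => F t - F 0); split=> [|t /andP[t0 t1]]; first by rewrite subrr.
have ih : lebesgue_measure.-integrable `[(-1), 1] (EFin \o h).
  apply: (@continuous_compact_integrable R h); first exact: segment_compact.
  exact: continuous_subspaceT.
have [dF DF] := continuous_FTC1_closed t1 ih t0 (ch t).
apply: is_derive_eq; first apply: is_deriveB.
  by apply: DeriveDef; [exact: dF|rewrite -derive1E; exact: DF].
by rewrite subr0.
Qed.

Variables (V : normedModType R) (bV : fbasis V).

Lemma primitive (h : R -> V) : continuous h -> exists H : R -> V,
  H 0 = 0 /\ forall t : R, -1 < t < 1 -> is_derive t 1 H (h t).
Proof.
move=> ch.
have chi i : continuous (fun t => fcoord bV i (h t)).
  move=> t; apply: (@continuous_comp _ _ _ h (fcoord bV i)); first exact: ch.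
  exact: fcoord_continuous.
have [H HH] := choice (fun i => primitive_real (chi i)).
exists (fun t => \sum_i H i t *: fvec bV i); split=> [|t t1].
  by rewrite big1// => i _; rewrite (HH i).1 scale0r.
have dHi i : differentiable (H i) t.
  by apply/derivable1_diffP; have [] := (HH i).2 t t1.
have lZ i : forall (c : R) (u v : R),
    (c *: u + v) *: fvec bV i = c *: (u *: fvec bV i) + v *: fvec bV i.
  by move=> c u v; rewrite scalerDl scalerA.
have cZ i : continuous (fun c : R => c *: fvec bV i) by exact: scalel_continuous.
have dHv i : differentiable (fun t => H i t *: fvec bV i) t.
  exact: (differentiable_linear_comp (lZ i) (cZ i)).
have [d D] := bigsum_diff dHv.
apply: DeriveDef; first exact: diff_derivable.
rewrite D [RHS](fexpand bV (h t)); apply: eq_bigr => i _.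
by rewrite (derive_linear_comp _ (lZ i) (cZ i))//; have [_ ->] := (HH i).2 t t1.
Qed.

(** [V] is not assumed complete: the limit is assembled from the limits of the coordinates, whose
    increments are dominated by a geometric series. *)
Lemma geometric_cauchy_cvg (u : nat -> V) (c : R) :
  (forall k, `|u k.+1 - u k| <= c * 2^-1 ^+ k) ->
  exists l : V, u @ \oo --> l /\ forall k, `|l - u k| <= 2 * c * 2^-1 ^+ k.
Proof.
move=> Hu.
have c0 : 0 <= c by have := Hu 0%N; rewrite expr0 mulr1; exact: le_trans.
have [M M0 HM] := fcoord_bounded bV.
have h1 : `|2^-1 : R| < 1 by rewrite ger0_norm ?invr_ge0// invf_lt1// ltr1n.
have ci i : cvgn (fun k => fcoord bV i (u k)).
  rewrite (_ : (fun k => _) = (fun k => fcoord bV i (u 0%N) +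
    series (telescope (fun k => fcoord bV i (u k))) k)); last first.
    by apply/funext => k; rewrite -eq_sum_telescope.
  apply: is_cvgD; first exact: is_cvg_cst.
  apply: normed_cvg; apply: (@series_le_cvg _ _ (geometric (M * c) 2^-1)).
  - by move=> n; exact: normr_ge0.
  - by move=> n; rewrite /geometric /= mulr_ge0 ?exprn_ge0 ?invr_ge0// mulr_ge0// ltW.
  - move=> n; rewrite /geometric /telescope /=.
    by rewrite -fcoordB; apply: le_trans (HM _ _) _; rewrite -mulrA ler_wpM2l// ltW.
  - exact: is_cvg_geometric_series.
pose l := \sum_i lim ((fun k => fcoord bV i (u k)) @ \oo) *: fvec bV i.
have ul : u @ \oo --> l.
  rewrite (_ : u = (fun k => \sum_i fcoord bV i (u k) *: fvec bV i)); last first.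
    by apply/funext => k; exact: fexpand.
  rewrite /l; elim: (index_enum _) => [|i s IH].
    by under eq_fun do rewrite big_nil; rewrite big_nil; exact: cvg_cst.
  under eq_fun do rewrite big_cons.
  by rewrite big_cons; apply: cvgD => //; apply: cvgZr_tmp; exact: ci.
exists l; split=> // k.
(* The factor 1 - 2^-m makes the induction on [m] close exactly; letting [m] grow gives the
   bound. *)
have Hm m : `|u (k + m)%N - u k| <= 2 * c * 2^-1 ^+ k * (1 - 2^-1 ^+ m).
  elim: m => [|m IH]; first by rewrite addn0 expr0 !subrr normr0 mulr0.
  rewrite addnS -(subrKA (u (k + m)%N)); apply: le_trans (ler_normD _ _) _.
  apply: le_trans (lerD (Hu _) IH) _.
  rewrite exprD exprS; set a := 2^-1 ^+ k; set b := 2^-1 ^+ m.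
  by rewrite le_eqVlt; apply/orP; left; apply/eqP; field.
have : (fun m => u (k + m)%N - u k) @ \oo --> l - u k.
  apply: cvgB; last exact: cvg_cst.
  rewrite (_ : (fun m => u (k + m)%N) = [sequence u (m + k)%N]_m).
    by rewrite cvg_shiftn.
  by apply/funext => m; rewrite addnC.
move=> /cvg_norm H.
apply: (@closed_cvg _ _ _ _ _ (fun x => x <= 2 * c * 2^-1 ^+ k) _ _ _ H).
  exact: closed_le.
apply: nearW => m; apply: le_trans (Hm m) _.
by rewrite ler_piMr ?mulr_ge0 ?exprn_ge0 ?invr_ge0// lerBlDr lerDl exprn_ge0 ?invr_ge0.
Qed.

End Picard.

(** * Picard iteration and regularity of solutions *)

Section LocalFlow.
Variables (R : realType) (V : normedModType R) (bV : fbasis V).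

(** Composition with this truncation to [-a, a] makes every Picard iterate a continuous function on
    the whole line. *)
Lemma clampP (a : R) : 0 < a ->
  let cl t := Num.max (- a) (Num.min a t) in
  [/\ continuous cl, forall t, `|cl t| <= a & forall t, `|t| <= a -> cl t = t].
Proof.
move=> a0 cl; split.
- move=> t; apply: (@continuous_max R R (fun=> - a) (fun t => Num.min a t)).
    exact: cst_continuous.
  apply: (@continuous_min R R (fun=> a) id); first exact: cst_continuous.
  exact: cvg_id.
- move=> t; rewrite ler_norml le_max lexx /= ge_max ge_min lexx /= andbT.
  by rewrite -subr_ge0 opprK addr_ge0// ltW.
- by move=> t; rewrite ler_norml => /andP[at1 ta]; rewrite /cl min_r// max_r.
Qed.

Lemma ode_exists (U : set V) (X : V -> V) u0 : open U -> U u0 -> Ck 1 U X ->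
  exists a : R, exists2 x : R -> V, 0 < a /\ x 0 = u0 &
    forall t : R, -a < t < a -> U (x t) /\ is_derive t 1 x (X (x t)).
Proof.
move=> oU Uu0 CX.
have [r [L [r0 L0 rU HL]]] := C1_locally_Lipschitz bV oU Uu0 CX.
have [C C0 HC] := mean_value_bound bV.
(* By the Lipschitz estimate from the centre, [K] bounds |X| on the ball of radius [r]. *)
pose K := `|X u0| + L * r.
have K0 : 0 < K by rewrite ltr_wpDl// mulr_gt0.
have HK u : ball u0 r u -> `|X u| <= K.
  move=> Bu; rewrite -(subrK (X u0) (X u)) addrC.
  apply: le_trans (ler_normD _ _) _; rewrite lerD2l.
  apply: le_trans (HL _ _ Bu (ballxx _ r0)) _; rewrite ler_pM2l//.
  by move: Bu; rewrite -ball_normE /= distrC => /ltW.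
(* a < 1 keeps times where primitives are differentiable, C K a <= r / 2 keeps the iterates in the
   half ball, and C L a <= 1/2 makes the Picard operator contract by 1/2. *)
have [a [a0 a1 aK aL]] : exists a : R, [/\ 0 < a, a < 1, C * (K * a) <= r / 2 &
    C * (L * a) <= 2^-1].
  have CK : 0 < C * K by rewrite mulr_gt0.
  have CL : 0 < C * L by rewrite mulr_gt0.
  pose p := r / 2 / (C * K); pose q := 2^-1 / (C * L).
  have p0 : 0 < p by rewrite !divr_gt0.
  have q0 : 0 < q by rewrite divr_gt0// invr_gt0.
  exists (Num.min 2^-1 (Num.min p q)); split.
  - by rewrite !lt_min p0 q0 invr_gt0 ltr0n.
  - by rewrite gt_min invf_lt1// ltr1n.
  - by rewrite mulrA mulrC -ler_pdivlMr// !ge_min lexx !orbT.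
  - by rewrite mulrA mulrC -ler_pdivlMr// !ge_min lexx !orbT.
have [ccl cla clid] := clampP a0.
set cl := (fun t => _) in ccl cla clid.
have cl1 (t s : R) : `|s| <= `|cl t| -> -1 < s < 1.
  by move=> st; rewrite -ltr_norml; apply: le_lt_trans a1; exact: le_trans (cla t).
have cl0 : cl 0 = 0 by apply: clid; rewrite normr0 ltW.
(* A total choice of primitives, with an arbitrary value at a discontinuous [h]. *)
have [P HP] : {P : (R -> V) -> (R -> V) | forall h, continuous h ->
    P h 0 = 0 /\ forall t : R, -1 < t < 1 -> is_derive t 1 (P h) (h t)}.
  have /choice[P HP] : forall h : R -> V, exists H : R -> V, continuous h ->
      H 0 = 0 /\ forall t : R, -1 < t < 1 -> is_derive t 1 H (h t).
    move=> h; have [ch|nch] := pselect (continuous h).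
      by have [H HH] := primitive bV ch; exists H.
    by exists h => /nch.
  by exists P.
pose T x := fun t => u0 + P (X \o x) (cl t).
pose good (x : R -> V) := continuous x /\ forall t, ball u0 r (x t).
have good_cX x : good x -> continuous (X \o x).
  move=> [cx bx] t; apply: continuous_comp; first exact: cx.
  exact/(Ck_continuous CX)/rU.
have good_bound x t : good x -> `|T x t - u0| <= r / 2.
  move=> gx; have cX := good_cX x gx; have [h0 dh] := HP _ cX.
  rewrite /T addrC addKr -[P _ _]subr0 -h0.
  have := HC (P (X \o x)) (X \o x) (cl t) K.
  move=> H; apply: le_trans (H _ _) _.
  - by move=> s /cl1; exact: dh.
  - by move=> s _; apply: HK; exact: gx.2.
  - by apply: le_trans aK; rewrite ler_pM2l// ler_pM2l//; exact: cla.
(* The closed bound r / 2 survives the passage to the limit and still lies in the open ball where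
   [X] is controlled. *)
have good_ball y : `|y - u0| <= r / 2 -> ball u0 r y.
  rewrite -ball_normE /= distrC => /le_lt_trans; apply.
  by rewrite ltr_pdivrMr// ltr_pMr// ltr1n.
have goodT x : good x -> good (T x).
  move=> gx; split=> t; last exact/good_ball/good_bound.
  apply: cvgD; first exact: cvg_cst.
  apply: (@continuous_comp _ _ _ cl); first exact: ccl.
  have [_ dh] := HP _ (good_cX x gx).
  apply: differentiable_continuous; apply/derivable1_diffP.
  by have [] := dh (cl t) (cl1 t _ (lexx _)).
have contr x y (d : R) t : good x -> good y -> (forall s, `|x s - y s| <= d) ->
    `|T x t - T y t| <= d / 2.
  move=> gx gy xyd.
  have [hx dx] := HP _ (good_cX x gx); have [hy dy] := HP _ (good_cX y gy).
  have d0 : 0 <= d by apply: le_trans (xyd 0).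
  have := HC (fun t => P (X \o x) t - P (X \o y) t) (fun t => X (x t) - X (y t))
    (cl t) (L * d).
  rewrite hx hy subrr subr0 /T => H.
  rewrite opprD addrACA subrr add0r.
  apply: le_trans (H _ _) _.
  - by move=> s /cl1 s1; apply: is_deriveB; [exact: dx|exact: dy].
  - move=> s _; apply: le_trans (HL _ _ (gx.2 s) (gy.2 s)) _.
    by rewrite ler_pM2l.
  - rewrite [leRHS]mulrC; apply: le_trans (ler_wpM2r d0 aL).
    rewrite -[leRHS]mulrA ler_pM2l// -!mulrA ler_pM2l// [leLHS]mulrC.
    exact: (ler_wpM2r d0 (cla t)).
pose x_ k := iter k T (fun=> u0).
have g_ k : good (x_ k).
  elim: k => [|k IH] /=; last exact: goodT.
  by split=> t; [exact: cvg_cst|exact: ballxx].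
have xk t k : `|x_ k.+1 t - x_ k t| <= (r / 2) * 2^-1 ^+ k.
  elim: k t => [|k IH] t; first by rewrite expr0 mulr1; exact: (good_bound _ t (g_ 0%N)).
  by rewrite exprS mulrCA [leRHS]mulrC; exact: (contr _ _ _ t (g_ k.+1) (g_ k) IH).
have [x Hx] := choice (fun t => geometric_cauchy_cvg bV (xk t)).
have {}Hx t : x_ ^~ t @ \oo --> x t /\ forall k, `|x t - x_ k t| <= r * 2^-1 ^+ k.
  have [h1 h2] := Hx t; split=> // k; apply: le_trans (h2 k) _.
  by rewrite mulrCA divff// mulr1.
have eps0 (e : R) : 0 < e -> exists k, r * 2^-1 ^+ k < e.
  move=> e0; have : (fun k => r * 2^-1 ^+ k) @ \oo --> (0 : R).
    have : `|2^-1 : R| < 1 by rewrite ger0_norm ?invr_ge0// invf_lt1// ltr1n.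
    move=> h1; rewrite -[X in _ --> X](mulr0 r).
    by apply: cvgM; [exact: cvg_cst|exact: cvg_expr].
  move/cvgrPdist_lt => /(_ _ e0) [k _ /(_ k (leqnn k))] /=.
  rewrite sub0r normrN => /(le_lt_trans (ler_norm _)); by exists k.
have gx : good x.
  split=> t.
    apply/cvgrPdist_lt => e e0.
    have e3 : 0 < e / 3 by rewrite divr_gt0.
    have [k Hk] := eps0 _ e3.
    have /cvgrPdist_lt/(_ _ e3) := (g_ k).1 t.
    apply: filterS => s Hs.
    have -> : x t - x s = (x t - x_ k t) + (x_ k t - x_ k s) + (x_ k s - x s).
      by rewrite subrKA subrKA.
    apply: le_lt_trans (ler_normD _ _) _.
    apply: (@le_lt_trans _ _ (`|x t - x_ k t| + `|x_ k t - x_ k s| + `|x_ k s - x s|)).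
      by rewrite lerD2r; exact: ler_normD.
    have A1 := (Hx t).2 k; have := (Hx s).2 k; rewrite distrC => A2.
    lra.
  apply: good_ball.
  have /cvg_norm H : (fun k => x_ k.+1 t - u0) @ \oo --> x t - u0.
    apply: cvgB; last exact: cvg_cst.
    by have := (Hx t).1; rewrite -(cvg_shiftS (x_ ^~ t)).
  apply: (@closed_cvg _ _ _ _ _ (fun x => x <= r / 2) _ _ _ H).
    exact: closed_le.
  by apply: nearW => k; exact: (good_bound _ t (g_ k)).
have fixx t : x t = T x t.
  apply/eqP; rewrite -subr_eq0 -normr_le0; apply/ler_addgt0Pl => e e0; rewrite addr0.
  have [k Hk] := eps0 _ e0.
  rewrite -(subrKA (x_ k.+1 t)); apply: le_trans (ler_normD _ _) _.
  have A1 := (Hx t).2 k.+1.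
  have A2 : `|x_ k.+1 t - T x t| <= r * 2^-1 ^+ k / 2.
    by apply: contr => // s; rewrite distrC; exact: (Hx s).2.
  apply: le_trans (lerD A1 A2) _; apply: le_trans (ltW Hk).
  rewrite exprS; set c := 2^-1 ^+ k; lra.
have cX := good_cX x gx; have [h0 dh] := HP _ cX.
exists a; exists x.
  by split=> //; rewrite fixx /T cl0 h0 addr0.
move=> t ta; split; first exact/rU/gx.2.
have t1 : -1 < t < 1.
  by move: ta => /andP[h1 h2]; rewrite (lt_trans _ h1) ?ltrN2//= (lt_trans h2 a1).
have D : is_derive t 1 (fun s => u0 + P (X \o x) s) (X (x t)).
  rewrite -[X (x t)]add0r; apply: is_deriveD; exact: dh.
(* Near an interior time the truncation is the identity, so the fixed point coincides with a
   differentiable function. *)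
apply: near_eq_is_derive D.
have : \forall s \near t, -a < s < a.
  have : nbhs t `]-a, a[%classic.
    by apply: open_nbhs_nbhs; split; [exact: interval_open|rewrite /= in_itv].
  by apply: filterS => s /=; rewrite in_itv.
apply: filterS => s; rewrite -ltr_norml => /ltW sa.
by rewrite fixx /T (_ : cl s = s)//; exact: clid.
Qed.

(** Bootstrapping: the derivative of [x] is X o x, so [x] gains one derivative at each turn. *)
Lemma ode_smooth (I : set R) (U : set V) (X : V -> V) (x : R -> V) :
  open I -> open U -> smooth_on U X ->
  (forall t, I t -> U (x t) /\ is_derive t 1 x (X (x t))) -> smooth_on I x.
Proof.
move=> oI oU sX Hx.
have dx t : I t -> differentiable x t.
  by move=> /Hx [_ [d _]]; apply/derivable1_diffP.
elim=> [|k IH]; first by move=> t It; exact/differentiable_continuous/dx.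
split=> // v.
apply: (@Ck_eq _ _ _ _ _ (fun t => v *: X (x t))) => //.
  move=> t It; rewrite -[v in RHS]mulr1 -[v * 1]/(v *: (1 : R)) deriveZdir; last exact: dx.
  by have [_ [_ ->]] := Hx _ It.
apply: CkZ => //.
by apply: (Ck_comp bV bV oI oU _ IH (sX k)) => t /Hx [].
Qed.

End LocalFlow.

(** * Finsler functions in a chart *)

Section Homogeneity.
Variables (R : realType) (n : nat).
Local Notation E := 'rV[R]_n.
Local Notation EE := (E * E)%type.

Definition fiberwise_homogeneous (U : set EE) (k : nat) (K : EE -> R) :=
  forall (x y : E) (l : R), 0 < l -> U (x, y) -> K (x, l *: y) = l ^+ k * K (x, y).

Definition conic (U : set EE) :=
  forall (x y : E) (l : R), 0 < l -> U (x, y) -> U (x, l *: y).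

Lemma fiber_scaling_linear (l c : R) (u v : EE) :
  ((c *: u + v).1, l *: (c *: u + v).2) = c *: (u.1, l *: u.2) + (v.1, l *: v.2).
Proof.
by congr pair; rewrite /= scalerDr !scalerA mulrC.
Qed.

Lemma fiber_scaling_continuous (l : R) :
  continuous (fun u : EE => (u.1, l *: u.2) : EE).
Proof.
move=> u; apply: (@cvg_pair _ _ _ (nbhs u) (nbhs u.1) (nbhs (l *: u.2))).
  exact: cvg_fst.
by apply: cvgZ; [exact: cvg_cst|exact: cvg_snd].
Qed.

(** Both sides differentiate K (x, l y) = l^k K (x, y); by the chain rule the fiber scaling
    multiplies the vertical part of the direction by [l]. *)
Lemma derive_homogeneous (U : set EE) k K (x y v w : E) (l : R) :
  open U -> conic U -> fiberwise_homogeneous U k K ->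
  (forall u, U u -> differentiable K u) -> 0 < l -> U (x, y) ->
  'D_(v, l *: w) K (x, l *: y) = l ^+ k * 'D_(v, w) K (x, y).
Proof.
move=> oU cU hK dK l0 Uxy.
have [ds Ds] := linear_diff (x, y) (@fiber_scaling_linear l)
  (@fiber_scaling_continuous l).
have dKl : differentiable K (x, l *: y) by apply/dK/cU.
have := derive_comp (v, w) ds dKl; rewrite Ds /= => <-.
have -> : l ^+ k * 'D_(v, w) K (x, y) = 'D_(v, w) (fun u => l ^+ k *: K u) (x, y).
  by rewrite (@deriveZ _ _ _ K)//; exact/diff_derivable/dK.
apply: near_eq_derive.
have : nbhs (x, y) U by exact: open_nbhs_nbhs.
by apply: filterS => -[x' y'] Uxy'; rewrite /= hK.
Qed.

(** The vertical direction itself carries one factor [l], which cancels against l^(k+1). *)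
Lemma derive_fiber_homogeneous (U : set EE) k K (e : E) :
  open U -> conic U -> fiberwise_homogeneous U k.+1 K ->
  (forall u, U u -> differentiable K u) ->
  fiberwise_homogeneous U k (fun u => 'D_(0, e) K u).
Proof.
move=> oU cU hK dK x y l l0 Uxy.
have := derive_homogeneous 0 e oU cU hK dK l0 Uxy.
have -> : (0 : E, l *: e) = l *: (0 : E, e).
  by rewrite -[RHS]/(_ *: _, _ *: _) scaler0.
rewrite deriveZdir; last exact/dK/cU.
by rewrite exprS -mulrA; apply: mulfI; rewrite gt_eqF.
Qed.

(** Differentiation of K (x, (1 + t) y) = (1 + t)^k K (x, y) at t = 0. *)
Lemma Euler (U : set EE) k K (x y : E) :
  open U -> fiberwise_homogeneous U k K -> differentiable K (x, y) -> U (x, y) ->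
  'D_(0, y) K (x, y) = k%:R * K (x, y).
Proof.
move=> oU hK dK Uxy.
have E0 : (x, y) + (0 : R) *: (0, y) = (x, y) by rewrite scale0r addr0.
have [_] : differentiable (fun t : R => K ((x, y) + t *: (0, y))) 0 /\
  'D_1 (fun t : R => K ((x, y) + t *: (0, y))) 0 =
  'D_(0, y) K ((x, y) + (0 : R) *: (0, y)).
  by apply: line_diff; rewrite E0.
rewrite E0 => <-.
have -> : 'D_1 (fun t : R => K ((x, y) + t *: (0, y))) 0 =
    'D_1 (fun t : R => (1 + t) ^+ k * K (x, y)) 0.
  apply: near_eq_derive; near=> t.
  have t0 : 0 < 1 + t.
    rewrite -ltrBlDl sub0r; near: t.
    by apply: lt_nbhsr; rewrite oppr_lt0.
  rewrite -hK//; congr K; rewrite -[LHS]/(_ + _ *: _, _ + _ *: _).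
  by rewrite scaler0 addr0 scalerDl scale1r.
have d1 : is_derive (0 : R) 1 (fun t : R => 1 + t) 1.
  rewrite -[X in is_derive _ _ _ X](add0r 1); apply: is_deriveD.
have [dX DX] := is_deriveX k d1.
have -> : (fun t : R => (1 + t) ^+ k * K (x, y)) =
    (fun t : R => K (x, y) *: ((fun t : R => 1 + t) ^+ k) t).
  by apply/funext => t; rewrite mulrC -[RHS]/(_ * _) fctE.
rewrite (@deriveZ _ _ _ ((fun t : R => 1 + t) ^+ k))// DX addr0 expr1n.
by rewrite [LHS]mulrC /GRing.scale /= !mulr1.
Unshelve. all: by end_near. Qed.

End Homogeneity.

Local Opaque derive.

Section VectorDirections.
Variables (R : realType) (n : nat).
Local Notation E := 'rV[R]_n.

Lemma derive_vertical_linear (K : E * E -> R) u (c : R) v v' :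
  differentiable K u ->
  'D_(0, c *: v + v') K u = c * 'D_(0, v) K u + 'D_(0, v') K u.
Proof.
have -> : (0 : E, c *: v + v') = c *: (0 : E, v) + (0, v').
  by rewrite -[RHS]/(_ *: _ + _, _ *: _ + _) scaler0 addr0.
by move=> dK; rewrite deriveDl// deriveZdir.
Qed.

Lemma derive_horizontal_linear (K : E * E -> R) u (c : R) v v' :
  differentiable K u ->
  'D_(c *: v + v', 0) K u = c * 'D_(v, 0) K u + 'D_(v', 0) K u.
Proof.
have -> : (c *: v + v', 0 : E) = c *: (v, 0 : E) + (v', 0).
  by rewrite -[RHS]/(_ *: _ + _, _ *: _ + _) scaler0 addr0.
by move=> dK; rewrite deriveDl// deriveZdir.
Qed.

Lemma derive_split (K : E * E -> R) u (v w : E) : differentiable K u ->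
  'D_(v, w) K u = 'D_(v, 0) K u + 'D_(0, w) K u.
Proof.
have -> : (v, w) = (v, 0 : E) + (0 : E, w).
  by rewrite -[RHS]/(_ + _, _ + _) add0r addr0.
by move=> dK; rewrite deriveDl.
Qed.

End VectorDirections.

(** * Metric, spray and Euler-Lagrange expression in a chart *)

Section LocalFinslerTheory.
Variables (R : realType) (n : nat).
Local Notation E := 'rV[R]_n.
Local Notation EE := (E * E)%type.

(** Coordinate form of a conic Finsler metric. It is instantiated by [F] over the slit bundle, by
    [F] over [D] and by the golden metric over [D], so that one theory serves all three. *)
Record local_finsler (U : set EE) (f : EE -> R) : Prop := LocalFinsler {
  lf_open : open U;
  lf_conic : conic U;
  lf_neq0 : forall u, U u -> u.2 != 0;
  lf_smooth : smooth_on U f;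
  lf_homogeneous : fiberwise_homogeneous U 1 f;
  lf_ge0 : forall u, U u -> 0 <= f u;
  lf_nondegenerate : forall u, U u -> Omega_nondegenerate f u }.

(* The Euler-Lagrange expression d/dt (dK/dy) - dK/dx of the Lagrangian K,
   along a curve with velocity [u.2] and acceleration [z], in the direction
   [e]. *)
Definition EL (K : EE -> R) (u : EE) (z e : E) : R :=
  'D_(u.2, z) (fun u' => 'D_(0, e) K u') u - 'D_(e, 0) K u.

Lemma EL_eq (U : set EE) (K K' : EE -> R) u z e : open U -> U u ->
  (forall v, U v -> K v = K' v) -> EL K u z e = EL K' u z e.
Proof.
move=> oU Uu KK'.
have nK v : U v -> \forall v' \near v, K v' = K' v'.
  by move=> Uv; have : nbhs v U by [exact: open_nbhs_nbhs]; apply: filterS => v' /KK'.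
have nU : nbhs u U by exact: open_nbhs_nbhs.
rewrite /EL; apply: (congr2 (fun p q => p - q)); last exact: near_eq_derive (nK _ Uu).
apply: near_eq_derive; move: nU; apply: filterS => v Uv.
exact: near_eq_derive (nK _ Uv).
Qed.

(** The vertical derivative of a 1-homogeneous [K] is 0-homogeneous, so Euler's relation kills its
    derivative along (0, y), and with it the tangential acceleration [m *: y]. *)
Lemma EL_reparam (U : set EE) K (x y z e : E) (s m : R) :
  open U -> conic U -> fiberwise_homogeneous U 1 K -> smooth_on U K ->
  0 < s -> U (x, y) ->
  EL K (x, s *: y) (s ^+ 2 *: z + m *: y) e = s * EL K (x, y) z e.
Proof.
move=> oU cU hK sK s0 Uxy.
have dK u : U u -> differentiable K u by exact: (sK 1%N).1.
have dKe u : U u -> differentiable (fun u' => 'D_(0, e) K u') u.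
  exact: ((sK 2%N).2 (0, e)).1.
have hKe := derive_fiber_homogeneous e oU cU hK dK.
rewrite /EL /=.
have -> : (s *: y, s ^+ 2 *: z + m *: y) =
    (s *: y, s *: (s *: z + (m / s) *: y)).
  by rewrite scalerDr !scalerA expr2 mulrCA divff ?gt_eqF// mulr1.
rewrite (derive_homogeneous _ _ oU cU hKe dKe s0 Uxy) expr0 mul1r.
have -> : (s *: y, s *: z + m / s *: y) = s *: (y, z) + (m / s) *: (0 : E, y).
  by rewrite -[RHS]/(_ *: _ + _ *: _, _ *: _ + _ *: _) scaler0 addr0.
rewrite deriveDl ?deriveZdir; try exact: dKe.
rewrite (Euler oU hKe (dKe _ Uxy) Uxy) mul0r scaler0 addr0.
have -> : (e, 0) = (e, s *: (0 : E)) by rewrite scaler0.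
rewrite (derive_homogeneous _ _ oU cU hK dK s0 Uxy) expr1.
by rewrite scaler0 mulrBr.
Qed.

Variables (U : set EE) (f : EE -> R).
Hypothesis F : local_finsler U f.

Let oU : open U := lf_open F.
Let cU : conic U := lf_conic F.

Lemma f2_smooth : smooth_on U (f2 f).
Proof. by move=> k; apply: CkM; [|exact: lf_smooth|exact: lf_smooth]. Qed.

Lemma f2_homogeneous : fiberwise_homogeneous U 2 (f2 f).
Proof.
move=> x y l l0 Uxy; rewrite /f2 (lf_homogeneous F)// expr1; ring.
Qed.

Let d1 u : U u -> differentiable (f2 f) u.
Proof. exact: (f2_smooth 1%N).1. Qed.

Let d2 e u : U u -> differentiable (fun u' => 'D_e (f2 f) u') u.
Proof. exact: ((f2_smooth 2%N).2 e).1. Qed.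

Let f2_Schwarz u d e : U u ->
  'D_d (fun u' => 'D_e (f2 f) u') u = 'D_e (fun u' => 'D_d (f2 f) u') u.
Proof.
by move=> Uu; exact: (Schwarz (fbasis_real R) d e oU Uu (f2_smooth 2%N)).
Qed.

(** J (0, z) = 0, so one of the two terms of [Omega] vanishes identically. *)
Lemma Omega_vertical u (z : E) (Y : EE) :
  Omega f u (0, z) Y = 2^-1 * 'D_(0, z) (fun u' => 'D_(0, Y.1) (f2 f) u') u.
Proof.
have h : dJf2 f (0, z) = fun=> 0 by apply/funext => v; exact: derive0.
have h' : 'D_Y (dJf2 f (0, z)) u = 0 by rewrite h; exact: (@derive_cst _ _ _ 0).
by apply: etrans (congr1 (fun p => 2^-1 * (_ - p)) h') _; rewrite subr0.
Qed.

Lemma metricE u (z w : E) :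
  metric f u z w = 2^-1 * 'D_(0, z) (fun u' => 'D_(0, w) (f2 f) u') u.
Proof. exact: Omega_vertical. Qed.

Lemma metric_symmetric u z w : U u -> metric f u z w = metric f u w z.
Proof.
move=> Uu; rewrite !metricE.
exact: (congr1 (fun p => 2^-1 * p) (f2_Schwarz (0, z) (0, w) Uu)).
Qed.

Local Opaque metric.

Lemma metric_linear u w (c : R) z z' : U u ->
  metric f u (c *: z + z') w = c * metric f u z w + metric f u z' w.
Proof.
move=> Uu; rewrite !metricE (derive_vertical_linear _ _ _ (d2 (0, w) Uu)).
by rewrite mulrDr mulrCA.
Qed.

Lemma metric_scale u w (c : R) z : U u ->
  metric f u (c *: z) w = c * metric f u z w.
Proof.
move=> Uu; have E0 : metric f u 0 w = 0.
  have := metric_linear w (-1) 0 0 Uu.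
  by rewrite scaler0 addr0 mulN1r addNr.
by have := metric_linear w c z 0 Uu; rewrite addr0 E0 addr0.
Qed.

Lemma metric_linearr u w (c : R) z z' : U u ->
  metric f u w (c *: z + z') = c * metric f u w z + metric f u w z'.
Proof. by move=> Uu; rewrite !(metric_symmetric w)// metric_linear. Qed.

Lemma metric_suml u w (I : finType) (c : I -> R) (z : I -> E) : U u ->
  metric f u (\sum_i c i *: z i) w = \sum_i c i * metric f u (z i) w.
Proof.
move=> Uu; elim: (index_enum I) => [|i s IH].
  rewrite !big_nil; have := metric_linear w (-1) 0 0 Uu.
  by rewrite scaler0 addr0 mulN1r addNr.
by rewrite !big_cons metric_linear// IH.
Qed.

Lemma metric_sumr u w (I : finType) (c : I -> R) (z : I -> E) : U u ->
  metric f u w (\sum_i c i *: z i) = \sum_i c i * metric f u w (z i).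
Proof.
move=> Uu; rewrite (metric_symmetric _ _ Uu) (metric_suml _ _ _ Uu).
by apply: eq_bigr => i _; rewrite (metric_symmetric _ w Uu).
Qed.

(** By [Omega_vertical], [Omega] pairs a vertical vector with [Y] only through the metric and
    [rho Y]. *)
Lemma metric_nondegenerate u z : U u -> (forall w, metric f u z w = 0) -> z = 0.
Proof.
move=> Uu H; have := lf_nondegenerate F Uu (X := (0, z)).
move=> /(_ _)/(congr1 snd); apply=> Y.
by rewrite Omega_vertical -metricE; exact: H.
Qed.

Lemma metric_mx_unit u : U u -> metric_mx f u \in unitmx.
Proof.
move=> Uu; rewrite unitmxE unitfE; apply/det0P => -[v v0 vG].
move/eqP: v0; apply; apply: (metric_nondegenerate Uu) => w.
rewrite (row_sum_delta w) (row_sum_delta v) metric_sumr// big1// => j _.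
rewrite metric_suml//; move/matrixP: vG => /(_ 0 j); rewrite !mxE.
under eq_bigr do rewrite mxE.
by move=> ->; rewrite mulr0.
Qed.

(** Turns a formula raised with the inverse matrix g^{il} into its lowered form; linearity of [b]
    makes its values on the basis determine it. *)
Lemma sharpP u (b : E -> R) w : U u ->
  (forall (c : R) v v', b (c *: v + v') = c * b v + b v') ->
  metric f u (sharp f u b) w = b w.
Proof.
move=> Uu lb.
have bsum (I : finType) (c : I -> R) (z : I -> E) :
    b (\sum_i c i *: z i) = \sum_i c i * b (z i).
  elim: (index_enum I) => [|i s IH]; last by rewrite !big_cons lb IH.
  rewrite !big_nil; have := lb (-1) 0 0.
  by rewrite scaler0 addr0 mulN1r addNr.
rewrite (row_sum_delta w) metric_sumr// bsum; apply: eq_bigr => j _; congr (_ * _).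
rewrite (row_sum_delta (sharp f u b)) metric_suml//.
have : (sharp f u b *m metric_mx f u) 0 j = b (ebase R j).
  by rewrite /sharp -mulmxA mulVmx ?metric_mx_unit// mulmx1 mxE.
by rewrite mxE => <-; apply: eq_bigr => i _; rewrite [X in _ = _ * X]mxE.
Qed.

(** dF^2/dy^e is 1-homogeneous in y, and this is Euler's relation for it. *)
Lemma metric_etal u e : U u -> metric f u u.2 e = 2^-1 * 'D_(0, e) (f2 f) u.
Proof.
case: u => x y Uu; rewrite metricE.
have := derive_fiber_homogeneous e oU cU f2_homogeneous d1.
by move=> /(Euler oU) /(_ (d2 _ Uu) Uu); rewrite mul1r => ->.
Qed.

Lemma metric_eta u : U u -> metric f u u.2 u.2 = f2 f u.
Proof.
case: u => x y Uu; rewrite metric_etal// (Euler oU f2_homogeneous (d1 Uu) Uu).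
by rewrite mulrA mulVf ?mul1r.
Qed.

Lemma derive_f2 u X : U u -> 'D_X (f2 f) u = 2 * f u * 'D_X f u.
Proof.
move=> Uu; have df : differentiable f u := (lf_smooth F 1%N).1 u Uu.
rewrite (_ : f2 f = fun u => f u * f u); last by apply/funext => v; rewrite /f2 expr2.
rewrite (@deriveM _ _ f f); [|exact: diff_derivable..].
by rewrite /GRing.scale /=; ring.
Qed.

(** At a zero of [f] the differential of F^2 vanishes, so the nonzero vector y would lie in the
    kernel of the metric. *)
Lemma lf_gt0 u : U u -> 0 < f u.
Proof.
move=> Uu; rewrite lt_neqAle (lf_ge0 F Uu) andbT; apply/eqP => /esym f0.
move/eqP: (lf_neq0 F Uu); apply; apply: (metric_nondegenerate Uu) => w.
by rewrite metric_etal// derive_f2// f0 mulr0 mul0r mulr0.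
Qed.

(** Lowering the index gives g (z + 2 G, e) = 1/2 EL (F^2) in the direction e ([key]), and
    nondegeneracy turns this into an equivalence. Apart from smoothness, it is how the spray is
    accessed from here on. *)
Lemma spray_EL u z : U u ->
  z + 2 *: spray f u = 0 <-> forall e, EL (f2 f) u z e = 0.
Proof.
move=> Uu.
(* The bracket in the definition of [spray] with the two derivatives exchanged: in this order its
   linearity in [e] is visible. *)
pose b e := 'D_(0, e) (fun u' => 'D_(u.2, 0) (f2 f) u') u - 'D_(e, 0) (f2 f) u.
have lb (c : R) v v' : b (c *: v + v') = c * b v + b v'.
  have lemma0 (p q r s : R) : c * p + q - (c * r + s) = c * (p - r) + (q - s).
    by ring.
  apply: etrans (lemma0 _ _ _ _).
  apply: (congr2 (fun p q => p - q)).
    exact: (derive_vertical_linear _ _ _ (d2 (u.2, 0) Uu)).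
  exact: (derive_horizontal_linear _ _ _ (d1 Uu)).
have sE : spray f u = 4^-1 *: sharp f u b.
  apply: (congr1 (fun b => 4^-1 *: sharp f u b)); apply/funext => e.
  exact: (congr1 (fun p => p - _) (f2_Schwarz (u.2, 0) (0, e) Uu)).
have key e : metric f u (z + 2 *: spray f u) e = 2^-1 * EL (f2 f) u z e.
  have -> : EL (f2 f) u z e = 'D_(0, z) (fun u' => 'D_(0, e) (f2 f) u') u + b e.
    have h := etrans (derive_split u.2 z (d2 (0, e) Uu))
      (congr1 (fun p => p + _) (f2_Schwarz (u.2, 0) (0, e) Uu)).
    have id1 (p q r : R) : p + q - r = q + (p - r) by ring.
    exact: etrans (congr1 (fun p => p - _) h) (id1 _ _ _).
  rewrite mulrDr -metricE addrC (metric_linear _ _ _ _ Uu) sE.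
  rewrite (metric_scale _ _ _ Uu) (sharpP _ Uu lb) mulrA addrC; congr (_ + _ * _).
  by field.
split=> [zs0 e|H].
  have := key e; rewrite zs0.
  have := metric_scale e 0 0 Uu; rewrite scale0r mul0r => -> /esym/eqP.
  by rewrite mulf_eq0 invr_eq0 pnatr_eq0 /= => /eqP.
by apply: (metric_nondegenerate Uu) => e; rewrite key H mulr0.
Qed.

End LocalFinslerTheory.

(** * Derivatives of families that are linear in a moving vector *)

Section DifferentialOfFamilies.
Variables (R : realType) (n : nat).
Local Notation E := 'rV[R]_n.
Local Notation EE := (E * E)%type.

Lemma linear_form_sum (b : E -> R) (v : E) :
  (forall (c : R) v v', b (c *: v + v') = c * b v + b v') ->
  b v = \sum_i v 0 i * b (delta_mx 0 i).
Proof.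
move=> lb; rewrite {1}(row_sum_delta v).
elim: (index_enum _) => [|i s IH]; last by rewrite !big_cons lb IH.
rewrite !big_nil; have := lb (-1) 0 0.
by rewrite scaler0 addr0 mulN1r addNr.
Qed.

(** Regularity of [G] is known for each fixed vector only, so [q] is expanded in coordinates, where
    the product rule applies. Its main use is the metric evaluated on a field or on y itself. *)
Lemma derive_family (V : normedModType R) (U : set V) (G : V -> E -> R)
    (q : V -> E) u X :
  open U -> U u -> (forall e, differentiable (G ^~ e) u) -> differentiable q u ->
  (forall u', U u' -> forall (c : R) v v', G u' (c *: v + v') = c * G u' v + G u' v') ->
  'D_X (fun u' => G u' (q u')) u = 'D_X (G ^~ (q u)) u + G u ('D_X q u).
Proof.
move=> oU Uu dG dq lG.
have nU : nbhs u U by exact: open_nbhs_nbhs.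
have dqi i : differentiable (fun u' => q u' 0 i) u /\
    'D_X (fun u' => q u' 0 i) u = ('D_X q u) 0 i.
  have lc : forall (c : R) (v w : E), (c *: v + w) 0 i = c *: v 0 i + w 0 i.
    by move=> c v w; rewrite !mxE.
  have cc : continuous (fun v : E => v 0 i) by exact: coord_continuous.
  split; first exact: (differentiable_linear_comp lc cc).
  exact: (derive_linear_comp _ lc cc).
have -> : 'D_X (fun u' => G u' (q u')) u =
    'D_X (fun u' => \sum_i q u' 0 i * G u' (delta_mx 0 i)) u.
  apply: near_eq_derive; move: nU; apply: filterS => u' Uu'.
  exact: linear_form_sum (lG _ Uu').
have -> : 'D_X (G ^~ (q u)) u =
    'D_X (fun u' => \sum_i q u 0 i *: G u' (delta_mx 0 i)) u.
  apply: near_eq_derive; move: nU; apply: filterS => u' Uu'.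
  exact: linear_form_sum (lG _ Uu').
have dqG i : differentiable (fun u' => q u' 0 i * G u' (delta_mx 0 i)) u.
  exact: (@differentiableM _ _ (fun u' => q u' 0 i) (G ^~ _) _ (dqi i).1 (dG _)).
have dcG i : differentiable (fun u' => q u 0 i *: G u' (delta_mx 0 i)) u.
  exact: (@differentiableZ _ _ _ (G ^~ _) _ _ (dG _)).
rewrite (bigsum_diff dqG).2 (bigsum_diff dcG).2 (linear_form_sum _ (lG _ Uu)).
rewrite -big_split; apply: eq_bigr => i _ /=.
rewrite (@deriveM _ _ (fun u' => q u' 0 i) (G ^~ _));
  [|exact/diff_derivable/(dqi i).1|exact: diff_derivable].
rewrite (@deriveZ _ _ _ (G ^~ _)); last exact: diff_derivable.
rewrite (dqi i).2 {2}/GRing.scale /=.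
by apply: (congr1 (fun p => _ + p)); exact: mulrC.
Qed.

Lemma differentiable_coords (V W : normedModType R) (bW : fbasis W) (g : V -> W) u :
  (forall i, differentiable (fun v => fcoord bW i (g v)) u) -> differentiable g u.
Proof.
move=> dg; rewrite (_ : g = fun v => \sum_i fcoord bW i (g v) *: fvec bW i); last first.
  by apply/funext => v; exact: fexpand.
apply: (bigsum_diff _).1 => i.
apply: (differentiable_linear_comp (l := fun c : R => c *: fvec bW i)) => //.
- by move=> c v w; rewrite scalerDl scalerA.
- exact: scalel_continuous.
Qed.

Lemma differentiable_family (V : normedModType R) (U : set V) (G : V -> E -> R)
    (q : V -> E) u :
  open U -> U u -> (forall e, differentiable (G ^~ e) u) -> differentiable q u ->
  (forall u', U u' -> forall (c : R) v v', G u' (c *: v + v') = c * G u' v + G u' v') ->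
  differentiable (fun u' => G u' (q u')) u.
Proof.
move=> oU Uu dG dq lG.
have H : \forall u' \near u, \sum_i q u' 0 i * G u' (delta_mx 0 i) = G u' (q u').
  have : nbhs u U by exact: open_nbhs_nbhs.
  by apply: filterS => u' Uu'; apply/esym; exact: linear_form_sum (lG _ Uu').
apply: near_eq_differentiable H _; apply: (bigsum_diff _).1 => i.
apply: (@differentiableM _ _ (fun u' => q u' 0 i) (G ^~ _)) => //.
apply: (differentiable_linear_comp (l := fun v : E => v 0 i)) => //.
- by move=> c v w; rewrite !mxE.
- exact: coord_continuous.
Qed.

Lemma derive_family_vec (V W : normedModType R) (bW : fbasis W) (U : set V)
    (G : V -> E -> W) (q : V -> E) u :
  open U -> U u -> (forall e, differentiable (G ^~ e) u) -> differentiable q u ->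
  (forall u', U u' -> forall (c : R) v v',
     G u' (c *: v + v') = c *: G u' v + G u' v') ->
  differentiable (fun u' => G u' (q u')) u /\
  forall X, 'D_X (fun u' => G u' (q u')) u = 'D_X (G ^~ (q u)) u + G u ('D_X q u).
Proof.
move=> oU Uu dG dq lG.
have dGi i e := differentiable_linear_comp (fcoord_linear bW i) (fcoord_continuous bW i) (dG e).
have lGi i u' : U u' -> forall (c : R) v v', fcoord bW i (G u' (c *: v + v')) =
    c * fcoord bW i (G u' v) + fcoord bW i (G u' v').
  by move=> Uu' c v v'; rewrite lG// fcoord_linear.
have d : differentiable (fun u' => G u' (q u')) u.
  apply: (differentiable_coords (bW := bW)) => i.
  exact: (differentiable_family oU Uu (dGi i) dq (lGi i)).
split=> // X; rewrite [LHS](fexpand bW) [RHS](fexpand bW).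
apply: eq_bigr => i _; apply: (congr1 (fun c => c *: fvec bW i)).
have ci := fcoord_linear bW i; have cc := fcoord_continuous bW i.
apply: etrans (esym (derive_linear_comp X ci cc d)) _.
apply: etrans (derive_family (G := fun v e => fcoord bW i (G v e)) X oU Uu
  (dGi i) dq (lGi i)) _.
have fD x y : fcoord bW i (x + y) = fcoord bW i x + fcoord bW i y.
  by rewrite -{1}[x]scale1r ci mul1r.
apply: etrans _ (esym (fD _ _)); apply: (congr1 (fun p => p + _)).
exact: (derive_linear_comp X ci cc (dG (q u))).
Qed.

Lemma fst_diff (u X : EE) : differentiable (@fst E E) u /\ 'D_X (@fst E E) u = X.1.
Proof.
have [d D] := @linear_diff _ EE E fst u (fun c v w => erefl) (fun v => cvg_fst).
by split.
Qed.

Lemma snd_diff (u X : EE) : differentiable (@snd E E) u /\ 'D_X (@snd E E) u = X.2.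
Proof.
have [d D] := @linear_diff _ EE E snd u (fun c v w => erefl) (fun v => cvg_snd).
by split.
Qed.

End DifferentialOfFamilies.

(** * Conservation of energy *)

Section EnergyConservation.
Variables (R : realType) (n : nat).
Local Notation E := 'rV[R]_n.
Local Notation EE := (E * E)%type.
Variables (U : set EE) (f : EE -> R).
Hypothesis F : local_finsler U f.

Let oU : open U := lf_open F.
Let cU : conic U := lf_conic F.

(** Euler's relation y^k dF^2/dy^k = 2 F^2 is differentiated; as the direction is frozen at [u.2],
    the contribution of the moving y is subtracted. *)
Lemma derive_Euler u X : U u ->
  'D_X (fun u' => 'D_(0, u.2) (f2 f) u') u =
  2 * 'D_X (f2 f) u - 'D_(0, X.2) (f2 f) u.
Proof.
move=> Uu; have s2 := f2_smooth F.
have d1 v : U v -> differentiable (f2 f) v by exact: (s2 1%N).1.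
have d2 e v : U v -> differentiable (fun u' => 'D_e (f2 f) u') v.
  exact: ((s2 2%N).2 e).1.
have := derive_family (G := fun u' e => 'D_(0, e) (f2 f) u') X oU Uu
  (fun e => d2 (0, e) u Uu) (snd_diff u X).1
  (fun u' Uu' c v v' => derive_vertical_linear c v v' (d1 _ Uu')).
rewrite (snd_diff u X).2 => H; apply: (addIr ('D_(0, X.2) (f2 f) u)).
rewrite subrK; apply: etrans (esym H) _.
apply: etrans _ (deriveZ 2 (diff_derivable (v := X) (d1 _ Uu))).
apply: near_eq_derive; have : nbhs u U by exact: open_nbhs_nbhs.
apply: filterS => -[x y] Uxy.
exact: (Euler oU (f2_homogeneous F) (d1 _ Uxy) Uxy).
Qed.

(** Contraction with y shows that F^2, hence F, has derivative zero along (y, z). Then EL (F^2) = 2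
    F EL (F) + 2 (derivative of F along (y, z)) dF/dy^e loses its last term. *)
Lemma EL_energy u z : U u -> (forall e, EL (f2 f) u z e = 0) ->
  'D_(u.2, z) f u = 0 /\ forall e, EL f u z e = 0.
Proof.
move=> Uu H.
have s2 := f2_smooth F.
have d1 v : U v -> differentiable (f2 f) v by exact: (s2 1%N).1.
have d2 e v : U v -> differentiable (fun u' => 'D_e (f2 f) u') v.
  exact: ((s2 2%N).2 e).1.
have df v : U v -> differentiable f v by exact: (lf_smooth F 1%N).1.
have df2 e v : U v -> differentiable (fun u' => 'D_e f u') v.
  exact: ((lf_smooth F 2%N).2 e).1.
have nU : nbhs u U by exact: open_nbhs_nbhs.
have f0 : 2 * f u != 0 by rewrite mulf_neq0// gt_eqF// (lf_gt0 F Uu).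
have Sf2 : 'D_(u.2, z) (f2 f) u = 0.
  have := derive_Euler (u.2, z) Uu; rewrite /=.
  have /eqP := H u.2; rewrite /EL subr_eq0 => /eqP ->.
  have := derive_split u.2 z (d1 _ Uu) => /eqP; rewrite -subr_eq => /eqP <-.
  move: ('D_(u.2, z) _ _) ('D_(0, z) _ _) => p q; lra.
have Sf : 'D_(u.2, z) f u = 0.
  have := derive_f2 F (u.2, z) Uu; rewrite Sf2 => /esym/eqP.
  by rewrite mulf_eq0 (negbTE f0) => /eqP.
split=> // e; have := H e; rewrite /EL (derive_f2 F _ Uu).
have -> : 'D_(u.2, z) (fun u' => 'D_(0, e) (f2 f) u') u =
          'D_(u.2, z) (fun u' => 2 *: (f u' * 'D_(0, e) f u')) u.
  apply: near_eq_derive; move: nU; apply: filterS => v Uv.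
  by rewrite (derive_f2 F _ Uv) -mulrA.
have dp : differentiable (fun u' => f u' * 'D_(0, e) f u') u.
  exact: (@differentiableM _ _ f (fun u' => 'D_(0, e) f u') _ (df _ Uu) (df2 _ _ Uu)).
rewrite (@deriveZ _ _ _ (fun u' => f u' * 'D_(0, e) f u')); last exact: diff_derivable.
rewrite (@deriveM _ _ f (fun u' => 'D_(0, e) f u'));
  [|exact/diff_derivable/df|exact/diff_derivable/df2].
rewrite Sf scaler0 addr0 => /eqP; rewrite -[_ *: (_ *: _)]/(2 * (f u * _)) mulrA.
by rewrite -mulrBr mulf_eq0 (negbTE f0) => /eqP.
Qed.

End EnergyConservation.

(** * Smoothness of the spray *)

Section SmoothSpray.
Variables (R : realType).

Lemma Ck_bigprod (V : normedModType R) k (U : set V) (I : finType)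
    (h : I -> V -> R) : open U ->
  (forall i, Ck k U (h i)) -> Ck k U (fun x => \prod_i h i x).
Proof.
move=> oU Hh; elim: (index_enum I) => [|i s IH].
  by under eq_fun do rewrite big_nil; exact: Ck_cst.
by under eq_fun do rewrite big_cons; exact: CkM.
Qed.

Lemma Ck_det (V : normedModType R) k (U : set V) m (A : V -> 'M[R]_m) : open U ->
  (forall i j, Ck k U (fun x => A x i j)) -> Ck k U (fun x => \det (A x)).
Proof.
move=> oU HA; apply: Ck_bigsum => // s; apply: CkM => //; first exact: Ck_cst.
exact: Ck_bigprod.
Qed.

(** Cramer's rule: the adjugate and the determinant are polynomial in the entries. *)
Lemma Ck_invmx (V : normedModType R) k (U : set V) m (A : V -> 'M[R]_m) i j :
  open U -> (forall x, U x -> A x \in unitmx) ->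
  (forall i j, Ck k U (fun x => A x i j)) -> Ck k U (fun x => invmx (A x) i j).
Proof.
move=> oU uA HA.
apply: (@Ck_eq _ _ _ _ _ (fun x => (\det (A x))^-1 * \adj (A x) i j)) => //.
  by move=> x Ux; rewrite /invmx (uA _ Ux) [RHS]mxE.
apply: CkM => //.
  apply: CkV => //; last exact: Ck_det.
  by move=> x /uA; rewrite unitmxE unitfE.
rewrite (_ : (fun x => _) = fun x => (-1) ^+ (j + i) *
    \det (row' j (col' i (A x)))); last by apply/funext => x; rewrite mxE.
apply: CkM => //; first exact: Ck_cst.
apply: Ck_det => // i' j'.
by under eq_fun do rewrite !mxE; exact: HA.
Qed.

Lemma Ck_row (V : normedModType R) k (U : set V) n (g : V -> 'rV[R]_n) : open U ->
  (forall j, Ck k U (fun x => g x 0 j)) -> Ck k U g.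
Proof.
move=> oU Hg; rewrite (_ : g = fun x => \sum_j g x 0 j *: delta_mx 0 j).
  by apply: Ck_bigsum => // j; exact: CkZl.
by apply/funext => x; exact: row_sum_delta.
Qed.

Lemma Ck_entry (V : normedModType R) k (U : set V) n (g : V -> 'rV[R]_n) j : open U ->
  Ck k U g -> Ck k U (fun x => g x 0 j).
Proof.
move=> oU; apply: (Ck_linear_comp (l := fun v : 'rV[R]_n => v 0 j)) => //.
  by move=> c u v; rewrite !mxE.
exact: coord_continuous.
Qed.

End SmoothSpray.

Local Opaque beta nonlin.

Section LinearCombination.
Variables (R : realType).

Lemma derive_lincomb (V : normedModType R) (p q : V -> R) u X (c : R) :
  differentiable p u -> differentiable q u ->
  'D_X (fun u' => c * p u' + q u') u = c * 'D_X p u + 'D_X q u.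
Proof.
move=> dp dq; rewrite (@deriveD _ _ _ (c \*: p) q);
  [|exact/diff_derivable/differentiableZ|exact: diff_derivable].
by rewrite (@deriveZ _ _ _ p)//; exact: diff_derivable.
Qed.

End LinearCombination.

Section SpraySmooth.
Variables (R : realType) (n : nat).
Local Notation E := 'rV[R]_n.
Local Notation EE := (E * E)%type.
Variables (U : set EE) (f : EE -> R).
Hypothesis F : local_finsler U f.

Let oU : open U := lf_open F.

Lemma metric_smooth z w : smooth_on U (fun u => metric f u z w).
Proof.
move=> k; apply: (@Ck_eq _ _ _ _ _ (fun u => 2^-1 *
    'D_(0, z) (fun u' => 'D_(0, w) (f2 f) u') u)) => //.
  by move=> u _; rewrite metricE.
apply: CkM => //; first exact: Ck_cst.
exact: ((f2_smooth F k.+2).2 (0, w)).2 (0, z).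
Qed.

Lemma spray_smooth : smooth_on U (spray f).
Proof.
move=> k; have s2 := f2_smooth F.
have oo : smooth_on U (fun u : EE => u.2).
  move=> m; apply: (@Ck_linear _ EE E) => // v; exact: cvg_snd.
pose b (u : EE) (e : E) : R := 'D_(u.2, 0) (fun u' => 'D_(gamma e) (f2 f) u') u
  - 'D_(e, 0) (f2 f) u.
have Cb e : Ck k U (b ^~ e).
  have d2 v : U v -> differentiable (fun u' => 'D_(gamma e) (f2 f) u') v.
    exact: ((s2 2%N).2 (gamma e)).1.
  (* The direction [(u.2, 0)] depends on the point, so the derivative is expanded over fixed
     coordinate directions. *)
  apply: (@Ck_eq _ _ _ _ _ (fun u : EE => (\sum_i u.2 0 i *
      'D_(delta_mx 0 i, 0) (fun u' => 'D_(gamma e) (f2 f) u') u) +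
      (-1) * 'D_(e, 0) (f2 f) u)) => //.
    move=> u Uu; rewrite mulN1r; apply: (congr1 (fun p => p - _)); apply/esym.
    apply: (linear_form_sum (b := fun v => 'D_(v, 0) (fun u' => 'D_(gamma e) (f2 f) u') u)).
    by move=> c v v'; exact: derive_horizontal_linear (d2 _ Uu).
  apply: CkD => //.
    apply: Ck_bigsum => // i; apply: CkM => //; first by apply: Ck_entry; [|exact: oo].
    exact: ((s2 k.+2).2 (gamma e)).2 (delta_mx 0 i, 0).
  by apply: CkM => //; [exact: Ck_cst|exact: (s2 k.+1).2 (e, 0)].
rewrite (_ : spray f = fun u => 4^-1 *: sharp f u (b u)); last exact/funext.
apply: CkZ => //; apply: Ck_row => // j.
rewrite (_ : (fun u => _) = fun u => \sum_l b u (ebase R l) * invmx (metric_mx f u) l j).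
  apply: Ck_bigsum => // l; apply: CkM => //.
  apply: Ck_invmx => //; first by move=> u; exact: metric_mx_unit.
  move=> i' j'; rewrite (_ : (fun u => _) = fun u => metric f u (ebase R i') (ebase R j')).
    exact: metric_smooth.
  by apply/funext => u; rewrite mxE.
by apply/funext => u; rewrite /sharp mxE; apply: eq_bigr => l _; rewrite mxE.
Qed.

End SpraySmooth.

(** * Concurrent fields in a chart *)

Section LocalConcurrent.
Variables (R : realType) (n : nat).
Local Notation E := 'rV[R]_n.
Local Notation EE := (E * E)%type.
Variables (U : set EE) (f : EE -> R) (a : EE -> E).
Hypothesis F : local_finsler U f.
Hypothesis da : forall u, U u -> differentiable a u.
Hypothesis a_gamma : forall u z, U u -> berwald_gamma a u z = 0.
Hypothesis a_cartan_gamma : forall u z, U u -> cartan_gamma f a u z = 0.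
Hypothesis a_cartan_beta : forall u z, U u -> cartan_beta f a u z = - z.

Let oU : open U := lf_open F.

Let dm z w u : U u -> differentiable (fun u' => metric f u' z w) u.
Proof. exact: (metric_smooth F z w 1%N).1. Qed.

Let m0 u w : U u -> metric f u 0 w = 0.
Proof. by move=> Uu; have := metric_scale F w 0 0 Uu; rewrite scale0r mul0r. Qed.

Definition local_B (e : E) (u : EE) : R := metric f u (a u) e.

Definition local_Bfrak (u : EE) : R := metric f u (a u) u.2.

(** As [a] has no vertical derivative, the Cartan equation along [gamma z] reduces to C (z, a) = 0,
    whose lowered form this is. *)
Lemma cartan_tensor_a u z e : U u ->
  'D_(0, e) (fun u' => metric f u' z (a u)) u = 0.
Proof.
move=> Uu; have := a_cartan_gamma z Uu; have := a_gamma z Uu.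
rewrite /berwald_gamma /cartan_gamma => ->; rewrite add0r /cartan_v => /eqP.
rewrite scaler_eq0 invr_eq0 pnatr_eq0 /= => /eqP s0.
pose b e := 'D_(gamma e) (fun u' => metric f u' z (a u)) u.
have lb (c : R) v v' : b (c *: v + v') = c * b v + b v'.
  by apply: derive_vertical_linear; exact: dm.
have := sharpP F e Uu lb; rewrite s0 (m0 _ Uu) => /esym; exact.
Qed.

Lemma differentiable_B e u : U u -> differentiable (local_B e) u.
Proof.
move=> Uu; apply: (differentiable_family (G := fun u' v => metric f u' v e) oU Uu).
- by move=> v; exact: dm.
- exact: da.
- by move=> u' Uu' c v v'; exact: (metric_linear F).
Qed.

Lemma derive_B e u X : U u ->
  'D_X (local_B e) u =
  'D_X (fun u' => metric f u' (a u) e) u + metric f u ('D_X a u) e.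
Proof.
move=> Uu.
apply: (derive_family (G := fun u' v => metric f u' v e) X oU Uu) => [v||].
- exact: dm.
- exact: da.
- by move=> u' Uu' c v v'; exact: (metric_linear F).
Qed.

Lemma derive_Bfrak u X : U u ->
  differentiable local_Bfrak u /\
  'D_X local_Bfrak u = 'D_X (local_B u.2) u + local_B X.2 u.
Proof.
move=> Uu.
have lB u' : U u' -> forall (c : R) v v',
    local_B (c *: v + v') u' = c * local_B v u' + local_B v' u'.
  by move=> Uu' c v v'; exact: (metric_linearr F).
have dBu v := differentiable_B v Uu; have ds := (snd_diff u X).1.
split; first exact: (differentiable_family (G := fun u' v => local_B v u') oU Uu dBu ds lB).
have := derive_family (G := fun u' v => local_B v u') X oU Uu dBu ds lB.
by rewrite (snd_diff u X).2.
Qed.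

(** Of the two terms in the product rule, one is the Cartan tensor applied to [a], the other
    contains the vertical derivative of [a]. *)
Lemma derive_B_vertical e u z : U u -> 'D_(0, z) (local_B e) u = 0.
Proof.
move=> Uu; rewrite derive_B//.
have := a_gamma z Uu; rewrite /berwald_gamma /gamma => ->.
rewrite (m0 _ Uu) addr0; apply: etrans (cartan_tensor_a e z Uu).
apply: near_eq_derive; have : nbhs u U by exact: open_nbhs_nbhs.
by apply: filterS => u' Uu'; exact: (metric_symmetric F _ _ Uu').
Qed.

Lemma derive_metric_symmetric u X v w : U u ->
  'D_X (fun u' => metric f u' v w) u = 'D_X (fun u' => metric f u' w v) u.
Proof.
move=> Uu; apply: near_eq_derive; have : nbhs u U by exact: open_nbhs_nbhs.
by apply: filterS => u' Uu'; exact: (metric_symmetric F _ _ Uu').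
Qed.

Lemma derive_metric_a u e v z : U u ->
  'D_(z, e) (fun u' => metric f u' v (a u)) u =
  'D_(z, 0) (fun u' => metric f u' v (a u)) u.
Proof.
by move=> Uu; rewrite (derive_split _ _ (dm _ _ Uu)) (cartan_tensor_a _ _ Uu) addr0.
Qed.

Lemma derive_metric_lincomb u X w (c : R) v v' : U u ->
  'D_X (fun u' => metric f u' (c *: v + v') w) u =
  c * 'D_X (fun u' => metric f u' v w) u + 'D_X (fun u' => metric f u' v' w) u.
Proof.
move=> Uu; have dv := dm v w Uu; have dv' := dm v' w Uu.
apply: etrans (derive_lincomb X c dv dv').
apply: near_eq_derive; have : nbhs u U by exact: open_nbhs_nbhs.
by apply: filterS => u' Uu'; exact: (metric_linear F w c v v' Uu').
Qed.

(** Lowered, [cartan_h] is half a Christoffel combination; it absorbs half of the derivative of the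
    metric in the product rule and leaves an expression symmetric in [z] and [e]. A metric
    contracted with [a] does not see the vertical part of [beta], so [beta] remains only in the
    derivative of g (e, z) along [a]. *)
Lemma derive_B_horizontal u z e : U u ->
  'D_(z, 0) (local_B e) u = - metric f u z e +
    2^-1 * ('D_(z, 0) (fun u' => metric f u' e (a u)) u
            + 'D_(e, 0) (fun u' => metric f u' z (a u)) u
            - 'D_(beta f u (a u)) (fun u' => metric f u' e z) u).
Proof.
move=> Uu.
have hz : 'D_(beta f u z) (local_B e) u = 'D_(z, 0) (local_B e) u.
  apply: etrans (derive_split z (- nonlin f u z) (differentiable_B e Uu)) _.
  by rewrite (derive_B_vertical e (- nonlin f u z) Uu) addr0.
apply: etrans (esym hz) _; apply: etrans (derive_B e _ Uu) _.
have h1 := etrans (derive_metric_symmetric (beta f u z) (a u) e Uu)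
  (derive_metric_a (- nonlin f u z) e z Uu).
apply: etrans (congr1 (fun p => p + _) h1) _.
have h2 : 'D_(beta f u z) a u = - z - cartan_h f u z (a u).
  by have := a_cartan_beta z Uu; rewrite /cartan_beta => <-; rewrite addrK.
apply: etrans (congr1 (fun p => _ + metric f u p e) h2) _.
pose b e := 'D_(beta f u z) (fun u' => metric f u' e (a u)) u
    + 'D_(beta f u (a u)) (fun u' => metric f u' e z) u
    - 'D_(beta f u e) (fun u' => metric f u' z (a u)) u.
have bE e' : b e' = 'D_(z, 0) (fun u' => metric f u' e' (a u)) u
    + 'D_(beta f u (a u)) (fun u' => metric f u' e' z) u
    - 'D_(e', 0) (fun u' => metric f u' z (a u)) u.
  have k1 := derive_metric_a (- nonlin f u z) e' z Uu.
  have k2 := derive_metric_a (- nonlin f u e') z e' Uu.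
  exact: (congr2 (fun p q => p + _ - q) k1 k2).
have lb (c : R) v v' : b (c *: v + v') = c * b v + b v'.
  have k1 := derive_metric_lincomb (z, 0) (a u) c v v' Uu.
  have k2 := derive_metric_lincomb (beta f u (a u)) z c v v' Uu.
  have k3 := derive_horizontal_linear c v v' (dm z (a u) Uu).
  rewrite !bE; apply: etrans (congr2 (fun p q => p - q) (congr2 +%R k1 k2) k3) _.
  have id1 (p1 p2 q1 q2 r1 r2 : R) : c * p1 + p2 + (c * q1 + q2) - (c * r1 + r2) =
      c * (p1 + q1 - r1) + (p2 + q2 - r2) by ring.
  exact: id1.
have h3 : - z - cartan_h f u z (a u) = (-1) *: z + (- 2^-1) *: sharp f u b.
  by rewrite scaleN1r scaleNr.
apply: etrans (congr1 (fun p => _ + metric f u p e) h3) _.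
have h4 : metric f u ((-1) *: z + (- 2^-1) *: sharp f u b) e =
    - metric f u z e - 2^-1 * b e.
  rewrite (metric_linear F _ _ _ _ Uu) (metric_scale F _ _ _ Uu) (sharpP F _ Uu lb).
  by rewrite mulN1r mulNr.
have id2 (p q r m : R) :
    p + (- m - 2^-1 * (p + q - r)) = - m + 2^-1 * (p + r - q) by field.
apply: etrans (congr1 (fun p => _ + p) h4) _.
apply: etrans (congr1 (fun p => _ + (_ - _ * p)) (bE e)) _.
exact: id2.
Qed.

Lemma B_closed u z e : U u -> 'D_(z, 0) (local_B e) u = 'D_(e, 0) (local_B z) u.
Proof.
move=> Uu.
have id1 (m p q r : R) : - m + 2^-1 * (p + q - r) = - m + 2^-1 * (q + p - r).
  by rewrite (addrC p).
have h := metric_symmetric F e z Uu.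
have h' := derive_metric_symmetric (beta f u (a u)) e z Uu.
apply: etrans (derive_B_horizontal z e Uu) _.
apply: etrans _ (esym (derive_B_horizontal e z Uu)).
apply: etrans (id1 _ _ _ _) _.
exact: (congr2 (fun p q => - p + 2^-1 * (_ - q)) (esym h) h').
Qed.

Lemma derive_metric_eta u X w : U u ->
  'D_X (fun u' => metric f u' u.2 w) u =
  2^-1 * 'D_X (fun u' => 'D_(0, w) (f2 f) u') u - metric f u X.2 w.
Proof.
move=> Uu.
have d2 : differentiable (fun u' => 'D_(0, w) (f2 f) u') u.
  exact: ((f2_smooth F 2%N).2 (0, w)).1.
have := derive_family (G := fun u' v => metric f u' v w) X oU Uu
  (fun v => dm v w Uu) (snd_diff u X).1
  (fun u' Uu' c v v' => metric_linear F w c v v' Uu').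
rewrite (snd_diff u X).2 => H; apply: (addIr (metric f u X.2 w)).
rewrite subrK; apply: etrans (esym H) _.
apply: etrans _ (deriveZ 2^-1 (diff_derivable (v := X) d2)).
apply: near_eq_derive; have : nbhs u U by exact: open_nbhs_nbhs.
by apply: filterS => u' Uu'; exact: (metric_etal F w Uu').
Qed.

(** C (y, y, .) = 0, so the vertical part of [X] drops out. In [derive_B_eta] this removes the
    nonlinear connection left in [beta f u (a u)]. *)
Lemma derive_metric_eta_eta u X : U u ->
  'D_X (fun u' => metric f u' u.2 u.2) u = 'D_(X.1, 0) (f2 f) u.
Proof.
move=> Uu; have d1 : differentiable (f2 f) u := (f2_smooth F 1%N).1 u Uu.
apply: etrans (derive_metric_eta X u.2 Uu) _.
apply: etrans (congr1 (fun p => 2^-1 * p - _) (derive_Euler F X Uu)) _.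
apply: etrans (congr1 (fun p => _ - p)
  (etrans (metric_symmetric F _ _ Uu) (metric_etal F X.2 Uu))) _.
have := derive_split X.1 X.2 d1; case: X => X1 X2 /= ->.
have id1 (p q : R) : 2^-1 * (2 * (p + q) - q) - 2^-1 * q = p by field.
exact: id1.
Qed.

Lemma derive_B_eta u : U u ->
  'D_(u.2, 0) (local_B u.2) u = - f2 f u +
    2^-1 * ('D_(u.2, 0) (fun u' => 'D_(0, a u) (f2 f) u') u - 'D_(a u, 0) (f2 f) u).
Proof.
move=> Uu.
apply: etrans (derive_B_horizontal u.2 u.2 Uu) _.
have h1 := metric_eta F Uu.
have h2 := derive_metric_eta (u.2, 0) (a u) Uu.
rewrite (m0 _ Uu) subr0 in h2.
have h3 := derive_metric_eta_eta (beta f u (a u)) Uu.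
apply: etrans (congr2 (fun p q => - p + 2^-1 * q) h1
  (congr2 (fun p q => p - q) (congr2 +%R h2 h2) h3)) _.
have id1 (m p q : R) : - m + 2^-1 * (2^-1 * p + 2^-1 * p - q) = - m + 2^-1 * (p - q).
  by field.
exact: id1.
Qed.

(** The correction in [derive_B_eta] and g (z, a) add up to half the Euler-Lagrange expression of
    F^2 in the direction [a], which vanishes. *)
Lemma derive_Bfrak_spray u z : U u -> (forall e, EL (f2 f) u z e = 0) ->
  'D_(u.2, z) local_Bfrak u = - f2 f u.
Proof.
move=> Uu H; have dB := differentiable_B u.2 Uu.
have d2 : differentiable (fun u' => 'D_(0, a u) (f2 f) u') u.
  exact: ((f2_smooth F 2%N).2 (0, a u)).1.
apply: etrans (derive_Bfrak (u.2, z) Uu).2 _.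
have h1 := derive_split u.2 z dB.
rewrite (derive_B_vertical _ _ Uu) addr0 in h1.
apply: etrans (congr1 (fun p => p + _) (etrans h1 (derive_B_eta Uu))) _.
have h2 := derive_split u.2 z d2.
have h3 := metricE f u z (a u).
have h4 := H (a u); rewrite /EL in h4.
have h5 : local_B z u = metric f u z (a u) := metric_symmetric F _ _ Uu.
rewrite h5 h3.
have id1 (m p q r s : R) : p = q + s -> p - r = 0 ->
    - m + 2^-1 * (q - r) + 2^-1 * s = - m.
  by move=> -> h; rewrite -[RHS]addr0 -(mulr0 2^-1) -h; field.
exact: (id1 _ _ _ _ _ h2 h4).
Qed.

Lemma derive_Bfrak_vertical u e : U u -> 'D_(0, e) local_Bfrak u = local_B e u.
Proof.
move=> Uu; rewrite (derive_Bfrak (0, e) Uu).2 (derive_B_vertical _ _ Uu).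
exact: add0r.
Qed.

(** Bfrak has vertical derivative B_e, a function of x only, so its expression is the exterior
    derivative of B on (y, e), whatever the acceleration. *)
Lemma EL_Bfrak u z e : U u -> EL local_Bfrak u z e = 0.
Proof.
move=> Uu; rewrite /EL.
have h1 : 'D_(u.2, z) (fun u' => 'D_(0, e) local_Bfrak u') u = 'D_(u.2, 0) (local_B e) u.
  apply: (@etrans _ _ ('D_(u.2, z) (local_B e) u)).
    apply: near_eq_derive; have : nbhs u U by exact: open_nbhs_nbhs.
    by apply: filterS => u' Uu'; exact: derive_Bfrak_vertical.
  apply: etrans (derive_split u.2 z (differentiable_B e Uu)) _.
  by rewrite (derive_B_vertical _ _ Uu) addr0.
have h2 : 'D_(e, 0) local_Bfrak u = 'D_(e, 0) (local_B u.2) u.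
  apply: etrans (derive_Bfrak (e, 0) Uu).2 _.
  have -> : local_B (e, 0 : E).2 u = 0.
    by apply: etrans (metric_symmetric F _ _ Uu) _; exact: m0.
  exact: addr0.
have h3 := etrans h1 (B_closed u.2 e Uu).
by apply/eqP; rewrite subr_eq0; apply/eqP; exact: (etrans h3 (esym h2)).
Qed.

(** * The golden metric in a chart *)

Definition local_golden (u : EE) : R :=
  local_Bfrak u ^+ 2 / f u - f u - local_Bfrak u.

(** The coefficients come from the partial derivatives of b^2 / c - c - b in b and c. *)
Lemma derive_golden u X : U u ->
  'D_X local_golden u = (2 * local_Bfrak u / f u - 1) * 'D_X local_Bfrak u
    - ((local_Bfrak u / f u) ^+ 2 + 1) * 'D_X f u.
Proof.
move=> Uu; have f0 : f u != 0 by rewrite gt_eqF// (lf_gt0 F Uu).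
have dB := (derive_Bfrak X Uu).1.
have df : differentiable f u := (lf_smooth F 1%N).1 u Uu.
have iB : is_derive u X local_Bfrak ('D_X local_Bfrak u).
  by apply: DeriveDef => //; exact: diff_derivable.
have iF : is_derive u X f ('D_X f u).
  by apply: DeriveDef => //; exact: diff_derivable.
have iV : is_derive u X (fun v => (f v)^-1) (- (f u) ^- 2 *: 'D_X f u).
  apply: DeriveDef; first by apply: derivableV => //; exact: diff_derivable.
  by apply: deriveV => //; exact: diff_derivable.
have [_ D] := is_deriveB (is_deriveB (is_deriveM (is_deriveM iB iB) iV) iF) iB.
have E1 : local_golden =
    local_Bfrak * local_Bfrak * (fun v => (f v)^-1) - f - local_Bfrak.
  by apply/funext => v; rewrite /local_golden expr2.
rewrite E1; apply: etrans D _.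
have id1 (b c p q : R) : c != 0 ->
  b * b * (- c ^- 2 * q) + c^-1 * (b * p + b * p) - q - p =
  (2 * b / c - 1) * p - ((b / c) ^+ 2 + 1) * q by move=> c0; field.
exact: (id1 _ _ _ _ f0).
Qed.

(** Since EL vanishes on F and on Bfrak, only the derivatives along the spray of the coefficients in
    [derive_golden] remain. For 2 Bfrak / F and (Bfrak / F)^2 they are - 2 F and - 2 Bfrak. *)
Lemma EL_golden u z e : U u -> (forall e, EL (f2 f) u z e = 0) ->
  EL local_golden u z e =
  - 2 * f u * local_B e u + 2 * local_Bfrak u * 'D_(0, e) f u.
Proof.
move=> Uu H; have f0 : f u != 0 by rewrite gt_eqF// (lf_gt0 F Uu).
have [Sf ELf] := EL_energy F Uu H.
have SB := derive_Bfrak_spray Uu H.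
have dB := (derive_Bfrak (u.2, z) Uu).1.
have df : differentiable f u := (lf_smooth F 1%N).1 u Uu.
have dfe : differentiable (fun u' => 'D_(0, e) f u') u.
  exact: ((lf_smooth F 2%N).2 (0, e)).1.
have iB : is_derive u (u.2, z) local_Bfrak (- f2 f u).
  by apply: DeriveDef; [exact: diff_derivable|exact: SB].
have iV : is_derive u (u.2, z) (fun v => (f v)^-1) 0.
  apply: DeriveDef; first by apply: derivableV => //; exact: diff_derivable.
  apply: etrans (deriveV f0 (diff_derivable df)) _.
  by rewrite Sf scaler0.
(* EL (Bfrak) = 0 is read as the value of the derivative of B_e along the spray, and EL (F) = 0 in
   [ife] likewise for dF/dy^e. *)
have ibe : is_derive u (u.2, z) (local_B e) ('D_(e, 0) local_Bfrak u).
  apply: DeriveDef; first exact/diff_derivable/differentiable_B.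
  apply: etrans (subr0_eq (EL_Bfrak z e Uu)).
  apply: near_eq_derive; have : nbhs u U by exact: open_nbhs_nbhs.
  by apply: filterS => u' Uu'; apply/esym; exact: derive_Bfrak_vertical.
have ife : is_derive u (u.2, z) (fun u' => 'D_(0, e) f u') ('D_(e, 0) f u).
  apply: DeriveDef; first exact: diff_derivable.
  exact: subr0_eq (ELf e).
have iA := is_deriveM iB iV.
have [_ D] := is_deriveB (is_deriveB (is_deriveB (is_deriveZ 2 (is_deriveM iA ibe)) ibe)
  (is_deriveM (is_deriveM iA iA) ife)) ife.
have E1 : 'D_(u.2, z) (fun u' => 'D_(0, e) local_golden u') u =
    'D_(u.2, z) (2 \*: (local_Bfrak * (fun v => (f v)^-1) * local_B e) - local_B e -
      local_Bfrak * (fun v => (f v)^-1) * (local_Bfrak * (fun v => (f v)^-1)) *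
        (fun u' => 'D_(0, e) f u') - (fun u' => 'D_(0, e) f u')) u.
  apply: near_eq_derive; have : nbhs u U by exact: open_nbhs_nbhs.
  apply: filterS => u' Uu'; apply: etrans (derive_golden (0, e) Uu') _.
  rewrite (derive_Bfrak_vertical _ Uu').
  have id0 (b v p q : R) : (2 * b * v - 1) * p - ((b * v) ^+ 2 + 1) * q =
    2 * (b * v * p) - p - b * v * (b * v) * q - q by ring.
  exact: id0.
rewrite /EL; apply: etrans (congr2 (fun p q => p - q) (etrans E1 D)
  (derive_golden (e, 0) Uu)) _.
have id1 (c b be fe b' f' : R) : c != 0 ->
  2 * ((b * c^-1) * b' + be * (b * 0 + c^-1 * - (c ^+ 2))) - b'
  - ((b * c^-1 * (b * c^-1)) * f' + fe * (b * c^-1 * (b * 0 + c^-1 * - (c ^+ 2))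
     + b * c^-1 * (b * 0 + c^-1 * - (c ^+ 2)))) - f'
  - ((2 * b / c - 1) * b' - ((b / c) ^+ 2 + 1) * f')
  = - 2 * c * be + 2 * b * fe by move=> c0; field.
exact: (id1 _ _ _ _ _ _ f0).
Qed.

(** Since g (y, e) = F dF/dy^e, multiplying the formula of [EL_golden] by - F / 2 gives g (F^2 a -
    Bfrak y, e). *)
Lemma golden_geodesic_radial u z : U u ->
  z + 2 *: spray f u = 0 -> (forall e, EL local_golden u z e = 0) ->
  f2 f u *: a u = local_Bfrak u *: u.2.
Proof.
move=> Uu /(spray_EL F z Uu) H G.
have f0 : f u != 0 by rewrite gt_eqF// (lf_gt0 F Uu).
apply/eqP; rewrite -subr_eq0; apply/eqP; apply: (metric_nondegenerate F Uu) => e.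
have h1 := etrans (esym (EL_golden e Uu H)) (G e).
have h2 := metric_etal F e Uu.
rewrite (derive_f2 F _ Uu) in h2.
have -> : f2 f u *: a u - local_Bfrak u *: u.2 =
    f2 f u *: a u + (- local_Bfrak u) *: u.2 by rewrite scaleNr.
rewrite (metric_linear F _ _ _ _ Uu) (metric_scale F _ _ _ Uu) h2.
have id1 (c b m d : R) : - 2 * c * m + 2 * b * d = 0 ->
   c ^+ 2 * m + - b * (2^-1 * (2 * c * d)) = 0.
  move=> h; rewrite -(mulr0 (- 2^-1 * c)) -h; by field.
exact: id1 h1.
Qed.

(** A vertical derivative along [w], with [a] fixed, turns the relation into dF^2(0, w) a = B_w y +
    Bfrak w. As [a] is parallel to y, so is every [w], which fails in dimension at least 2. *)
Lemma not_radial (W : set EE) u : (2 <= n)%N -> open W -> W `<=` U -> W u ->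
  a u != 0 -> ~ (forall v, W v -> f2 f v *: a v = local_Bfrak v *: v.2).
Proof.
move=> n2 oW WU Wu a0 H; have Uu := WU _ Wu.
have f0 : f2 f u != 0 by rewrite /f2 expf_neq0// gt_eqF// (lf_gt0 F Uu).
have B0 : local_Bfrak u != 0.
  apply/eqP => B0; have /eqP := H u Wu; rewrite B0 scale0r scaler_eq0.
  by rewrite (negbTE f0) (negbTE a0).
have [i0 [i1 i01]] : exists i0 i1 : 'I_n, i0 != i1.
  exists (Ordinal (ltn_trans (ltnSn 0) n2)), (Ordinal n2); exact/eqP.
have d1 : differentiable (f2 f) u := (f2_smooth F 1%N).1 u Uu.
have dB := (derive_Bfrak 0 Uu).1.
have entry_lin (i : 'I_n) : forall (c : R) (v w : E), (c *: v + w) 0 i = c *: v 0 i + w 0 i.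
  by move=> c v w; rewrite !mxE.
have entry_cont (i : 'I_n) : continuous (fun v : E => v 0 i) by exact: coord_continuous.
have key (w : E) : exists c : R, forall i,
    f2 f u * local_Bfrak u * w 0 i = c * (u.2 : E) 0 i.
  (* Multiply the differentiated relation by F^2 and substitute F^2 a = Bfrak y: this is the
     coefficient of y. *)
  exists ('D_(0, w) (f2 f) u * local_Bfrak u - f2 f u * local_B w u) => i.
  have da' := differentiable_linear_comp (entry_lin i) (@entry_cont i) (da Uu).
  have Da := derive_linear_comp (0, w) (entry_lin i) (@entry_cont i) (da Uu).
  have {}Da : 'D_(0, w) (fun v => a v 0 i) u = 0.
    apply: etrans Da _; apply: etrans (congr1 (fun v : E => v 0 i) (a_gamma w Uu)) _.
    exact: mxE.
  have dy' := differentiable_linear_comp (entry_lin i) (@entry_cont i) (snd_diff u (0, w)).1.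
  have Dy := derive_linear_comp (0, w) (entry_lin i) (@entry_cont i) (snd_diff u (0, w)).1.
  rewrite (snd_diff u (0, w)).2 /= in Dy.
  have h : 'D_(0, w) (f2 f * (fun v => a v 0 i)) u =
           'D_(0, w) (local_Bfrak * (fun v : EE => (v.2 : E) 0 i)) u.
    apply: near_eq_derive; have : nbhs u W by exact: open_nbhs_nbhs.
    by apply: filterS => v Wv; have /matrixP/(_ 0 i) := H v Wv; rewrite !mxE.
  have h' : f2 f u * a u 0 i = local_Bfrak u * (u.2 : E) 0 i.
    by have /matrixP/(_ 0 i) := H u Wu; rewrite !mxE.
  have e1 := deriveM (diff_derivable (v := (0, w)) d1) (diff_derivable (v := (0, w)) da').
  have e2 := deriveM (diff_derivable (v := (0, w)) dB) (diff_derivable (v := (0, w)) dy').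
  have e3 := etrans (esym e1) (etrans h e2).
  rewrite Da Dy (derive_Bfrak_vertical w Uu) in e3.
  have id1 (p b ai y wi q r : R) : p * 0 + ai * q = b * wi + y * r -> p * ai = b * y ->
      p * b * wi = (q * b - p * r) * y.
    move=> k1 k2; have k3 : b * wi = ai * q - y * r.
      by apply/eqP; rewrite eq_sym subr_eq -k1 mulr0 add0r.
    have -> : p * b * wi = p * ai * q - p * y * r by rewrite -mulrA k3; ring.
    by rewrite k2; ring.
  exact: (id1 _ _ _ _ _ _ _ e3 h').
have fB0 : f2 f u * local_Bfrak u != 0 by rewrite mulf_neq0.
(* The first basis vector forces the entry [i1] of y to vanish; then the second one gives F^2 Bfrak
   = 0 at that entry. *)
have [c0 Hc0] := key (delta_mx 0 i0); have [c1 Hc1] := key (delta_mx 0 i1).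
have := Hc0 i0; rewrite mxE !eqxx mulr1 => k0.
have := Hc0 i1; rewrite mxE eqxx (eq_sym i1) (negbTE i01) mulr0 => /esym/eqP.
have c00 : c0 != 0 by apply/eqP => c00; move: fB0; rewrite k0 c00 mul0r eqxx.
rewrite mulf_eq0 (negbTE c00) /= => /eqP y1.
have := Hc1 i1; rewrite mxE !eqxx mulr1 y1 mulr0 => k1.
by move: fB0; rewrite k1 eqxx.
Qed.

End LocalConcurrent.

(** * Changes of charts *)

Section Charts.
Variables (R : realType) (n : nat) (M : manifold R n).
Local Notation E := 'rV[R]_n.
Local Notation EE := (E * E)%type.
Implicit Types (i j k : chart M) (x y : E) (u : EE).

Local Notation coord := Defs.coord.

Let bE : fbasis E := fbasis_rV R n.

Definition overlap i j : set E := coord i @` (dom i `&` dom j).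

Definition transition i j : E -> E := coord j \o param i.

Lemma cod_param i x : cod i x -> dom i (param i x) /\ coord i (param i x) = x.
Proof. by move=> [p ip <-]; rewrite coordK. Qed.

Lemma overlapP i j x : overlap i j x <-> cod i x /\ dom j (param i x).
Proof.
split=> [[p [ip jp] <-]|[/cod_param[ix e] jx]].
  by rewrite coordK//; split=> //; exists p.
by exists (param i x).
Qed.

Lemma overlap_cod i j x : overlap i j x -> cod i x.
Proof. by move=> /overlapP[]. Qed.

Lemma overlap_open i j : open (overlap i j).
Proof.
rewrite openE => x /overlapP[ix jx]; rewrite /interior.
have n1 : nbhs x (cod i) by apply: open_nbhs_nbhs; split=> //; exact: cod_open.
have n2 : nbhs x (param i @^-1` dom j).
  by apply: (param_continuous ix); apply: open_nbhs_nbhs; split=> //; exact: dom_open.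
by move: n1 n2; apply: filterS2 => z iz jz; apply/overlapP.
Qed.

Lemma overlap_refl i x : cod i x -> overlap i i x.
Proof. by move=> ix; apply/overlapP; split=> //; have [] := cod_param ix. Qed.

Lemma overlap_chart_at i x : cod i x -> overlap i (chart_at (param i x)) x.
Proof. by move=> ix; apply/overlapP; split=> //; exact: chart_atP. Qed.

Lemma transition_smooth_overlap i j : smooth_on (overlap i j) (transition i j).
Proof. exact: transition_smooth. Qed.

Lemma param_transition i j x : overlap i j x -> param j (transition i j x) = param i x.
Proof. by move=> /overlapP[_ jx]; rewrite /transition /= coordK. Qed.

Lemma overlap_transition i j k x : overlap i j x -> overlap i k x ->
  overlap j k (transition i j x).
Proof.
move=> ijx /overlapP[_ kx]; apply/overlapP; rewrite param_transition//; split=> //.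
by have /overlapP[_ jx] := ijx; exists (param i x).
Qed.

Lemma transition_differentiable i j x : overlap i j x ->
  differentiable (transition i j) x.
Proof. exact: (transition_smooth_overlap i j 1%N).1. Qed.

Lemma transfer_linear i j x (c : R) y y' : overlap i j x ->
  transfer i j x (c *: y + y') = c *: transfer i j x y + transfer i j x y'.
Proof.
by move=> /transition_differentiable d; rewrite /transfer deriveDl// deriveZdir.
Qed.

Lemma transfer_scale i j x (c : R) y : overlap i j x ->
  transfer i j x (c *: y) = c *: transfer i j x y.
Proof. by move=> /transition_differentiable d; exact: deriveZdir. Qed.

(** Chain rule on the cocycle relation of the transition maps, which holds near [x] because overlaps
    are open. *)
Lemma transfer_comp i j k x y : overlap i j x -> overlap i k x ->
  transfer j k (transition i j x) (transfer i j x y) = transfer i k x y.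
Proof.
move=> ijx ikx; rewrite /transfer.
apply: etrans (esym (derive_comp y (transition_differentiable ijx)
  (transition_differentiable (overlap_transition ijx ikx)))) _.
apply: near_eq_derive.
have : nbhs x (overlap i j) by apply: open_nbhs_nbhs; split=> //; exact: overlap_open.
by apply: filterS => z ijz; exact: (congr1 (coord k) (param_transition ijz)).
Qed.

Lemma transfer_refl i x y : cod i x -> transfer i i x y = y.
Proof.
move=> ix; apply: etrans _ (@derive_id _ _ x y); apply: near_eq_derive.
have : nbhs x (cod i) by apply: open_nbhs_nbhs; split=> //; exact: cod_open.
by apply: filterS => z /cod_param[].
Qed.

Lemma transition_back i j x : overlap i j x -> transition j i (transition i j x) = x.
Proof.
move=> ijx; rewrite {1}/transition /= param_transition//.
by have /overlap_cod/cod_param[] := ijx.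
Qed.

Lemma transferK i j x y : overlap i j x ->
  transfer j i (transition i j x) (transfer i j x y) = y.
Proof.
move=> ijx; have ix := overlap_cod ijx.
by rewrite (transfer_comp _ ijx (overlap_refl ix)) transfer_refl.
Qed.

Lemma transferVK i j x y : overlap i j x ->
  transfer i j x (transfer j i (transition i j x) y) = y.
Proof.
move=> ijx; have ix := overlap_cod ijx.
have jix := overlap_transition ijx (overlap_refl ix).
by have := transferK y jix; rewrite transition_back.
Qed.

Lemma transfer_eq0 i j x y : overlap i j x -> (transfer i j x y == 0) = (y == 0).
Proof.
move=> ijx; apply/eqP/eqP => [h|->]; last by rewrite /transfer derive0.
by rewrite -(transferK y ijx) h /transfer derive0.
Qed.

Definition Ttransition i j u : EE := (transition i j u.1, transfer i j u.1 u.2).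

Definition Toverlap i j : set EE := [set u | overlap i j u.1].

Lemma Toverlap_open i j : open (Toverlap i j).
Proof.
apply: (@open_comp _ _ fst (overlap i j)) => [u _|]; first exact: cvg_fst.
exact: overlap_open.
Qed.

(** Both sides use the chart selected at the same base point, and the cocycle property of [transfer]
    identifies the components. *)
Lemma Tparam_transition i j u : Toverlap i j u -> Tparam j (Ttransition i j u) = Tparam i u.
Proof.
case: u => x y ijx; have ix := overlap_cod ijx.
pose P p : TM M := (p, transfer j (chart_at p) (transition i j x) (transfer i j x y)).
apply: etrans (congr1 P (param_transition ijx)) _.
exact: (congr1 (pair _) (transfer_comp y ijx (overlap_chart_at ix))).
Qed.

Lemma local_fun_transition (F : TM M -> R) i j u : Toverlap i j u ->
  local_fun F i u = local_fun F j (Ttransition i j u).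
Proof. by move=> iju; rewrite /local_fun Tparam_transition. Qed.

Lemma transfer_diff i j (y : E) x : overlap i j x ->
  differentiable (fun z => transfer i j z y) x.
Proof. exact: ((transition_smooth_overlap i j 2%N).2 y).1. Qed.

Lemma Ttransfer_diff i j u : Toverlap i j u ->
  differentiable (fun v : EE => transfer i j v.1 v.2) u /\
  forall X : EE, 'D_X (fun v : EE => transfer i j v.1 v.2) u =
    'D_(X.1) (fun z => transfer i j z u.2) u.1 + transfer i j u.1 X.2.
Proof.
move=> iju; have oT := @Toverlap_open i j.
have dG (y : E) : differentiable (fun v : EE => transfer i j v.1 y) u.
  apply: (@differentiable_comp _ _ _ _ fst (fun z => transfer i j z y)).
    exact: (fst_diff u 0).1.
  exact: transfer_diff.
have [d D] := derive_family_vec (G := fun (v : EE) y => transfer i j v.1 y)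
  bE oT iju dG (snd_diff u 0).1
  (fun v iv c y y' => transfer_linear c y y' iv).
split; first exact: d.
move=> X; apply: etrans (D X) _.
have h1 := derive_comp (g := fun z => transfer i j z u.2) X (fst_diff u X).1
  (transfer_diff u.2 iju).
have h2 := congr1 (fun v => 'D_v (fun z => transfer i j z u.2) u.1) (fst_diff u X).2.
have h3 := congr1 (transfer i j u.1) (snd_diff u X).2.
exact: (congr2 +%R (etrans h1 h2) h3).
Qed.

(** The differential is block triangular; its off-diagonal block, a second derivative of the
    transition map, is the source of the non-tensorial terms below. *)
Lemma Ttransition_diff i j u : Toverlap i j u ->
  differentiable (Ttransition i j) u /\
  forall X : EE, 'D_X (Ttransition i j) u =
    (transfer i j u.1 X.1,
     'D_(X.1) (fun z => transfer i j z u.2) u.1 + transfer i j u.1 X.2).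
Proof.
move=> iju; have [d2 D2] := Ttransfer_diff iju.
have df := transition_differentiable iju.
have d1 : differentiable (fun v : EE => transition i j v.1) u.
  exact: (@differentiable_comp _ _ _ _ fst (transition i j) _ (fst_diff u 0).1).
have d : differentiable (Ttransition i j) u.
  exact: (differentiable_pair d1 d2).
split; first exact: d.
move=> X.
have e0 : 'D_X (Ttransition i j) u = ('D_X (fun v : EE => transition i j v.1) u,
    'D_X (fun v : EE => transfer i j v.1 v.2) u).
  by rewrite (deriveE _ d) (deriveE _ d1) (deriveE _ d2) (diff_pair d1 d2).
apply: etrans e0 _; apply: (congr2 pair) (D2 X).
have h1 := derive_comp (g := transition i j) X (fst_diff u X).1 df.
apply: etrans h1 _; rewrite /transfer.
exact: (congr1 (fun v => 'D_v (transition i j) u.1) (fst_diff u X).2).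
Qed.

End Charts.

(** * Covariance of the metric and of the Euler-Lagrange expression *)

Section Covariance.
Variables (R : realType) (n : nat) (M : manifold R n).
Local Notation E := 'rV[R]_n.
Local Notation EE := (E * E)%type.
Variables (D : set (TM M)) (F : TM M -> R).
Hypothesis LF : forall i, local_finsler (Tset i D) (local_fun F i).
Variables (i j : chart M).

Local Notation T := (Ttransition i j).
Local Notation tr := (transfer i j).
Local Notation fi := (local_fun F i).
Local Notation fj := (local_fun F j).

Lemma transfer0 x : tr x 0 = 0.
Proof. exact: derive0. Qed.

Lemma Tset_transition u : Tset i D u -> Toverlap i j u -> Tset j D (T u).
Proof.
move=> [_ Du] iju; split; last by rewrite Tparam_transition.
exact: overlap_cod (overlap_transition iju (overlap_refl (overlap_cod iju))).
Qed.

Let W : set EE := Tset i D `&` Toverlap i j.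

Let oW : open W.
Proof. by apply: openI; [exact: lf_open (LF i)|exact: Toverlap_open]. Qed.

Let nW u : W u -> nbhs u W.
Proof. by move=> Wu; exact: open_nbhs_nbhs. Qed.

Lemma derive_f2_transition u X : W u ->
  'D_X (f2 fi) u = 'D_('D_X T u) (f2 fj) (T u).
Proof.
move=> Wu; have [d _] := Ttransition_diff Wu.2.
have dj := (f2_smooth (LF j) 1%N).1 _ (Tset_transition Wu.1 Wu.2).
apply: etrans _ (derive_comp X d dj).
apply: near_eq_derive; have := nW Wu.
by apply: filterS => v Wv; rewrite /f2 /= (local_fun_transition F Wv.2).
Qed.

Lemma derive_f2_vertical_transition u e : W u ->
  'D_(0, e) (f2 fi) u = 'D_(0, tr u.1 e) (f2 fj) (T u).
Proof.
move=> Wu; apply: etrans (derive_f2_transition (0, e) Wu) _.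
apply: (congr1 (fun v => 'D_v (f2 fj) (T u))).
apply: etrans ((Ttransition_diff Wu.2).2 (0, e)) _.
apply: (congr2 pair); first exact: transfer0.
apply: etrans (congr1 (fun p => p + _) (derive0 _ _)) _; exact: add0r.
Qed.

(** The second summand is due to the constant vector [e], whose components in the chart [j] vary
    with the base point. *)
Lemma derive2_f2_transition u X e : W u ->
  'D_X (fun v => 'D_(0, e) (f2 fi) v) u =
  'D_('D_X T u) (fun v => 'D_(0, tr u.1 e) (f2 fj) v) (T u) +
  'D_(0, 'D_(X.1) (fun z => tr z e) u.1) (f2 fj) (T u).
Proof.
move=> Wu; have [d _] := Ttransition_diff Wu.2.
have sj := f2_smooth (LF j).
have dj v : W v -> differentiable (f2 fj) (T v).
  by move=> Wv; exact: ((sj 1%N).1 _ (Tset_transition Wv.1 Wv.2)).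
have dj2 e' : differentiable (fun v => 'D_(0, e') (f2 fj) v) (T u).
  exact: (((sj 2%N).2 (0, e')).1 _ (Tset_transition Wu.1 Wu.2)).
have dG (e' : E) : differentiable (fun v : EE => 'D_(0, e') (f2 fj) (T v)) u.
  exact: (differentiable_comp (g := fun v => 'D_(0, e') (f2 fj) v) d (dj2 e')).
have dt := transfer_diff e Wu.2.
have dq : differentiable (fun v : EE => tr v.1 e) u.
  exact: (differentiable_comp (g := fun z => tr z e) (fst_diff u 0).1 dt).
have Dq : 'D_X (fun v : EE => tr v.1 e) u = 'D_(X.1) (fun z => tr z e) u.1.
  apply: etrans (derive_comp (g := fun z => tr z e) X (fst_diff u X).1 dt) _.
  exact: (congr1 (fun v => 'D_v (fun z => tr z e) u.1) (fst_diff u X).2).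
have H := derive_family (G := fun v e' => 'D_(0, e') (f2 fj) (T v)) X oW Wu dG dq
  (fun v Wv c p q => derive_vertical_linear c p q (dj v Wv)).
apply: (@etrans _ _ ('D_X (fun v => 'D_(0, tr v.1 e) (f2 fj) (T v)) u)).
  apply: near_eq_derive; have := nW Wu.
  by apply: filterS => v Wv; exact: derive_f2_vertical_transition.
apply: etrans H _; apply: (congr2 +%R).
  exact: (derive_comp (g := fun v => 'D_(0, tr u.1 e) (f2 fj) v) X d (dj2 _)).
exact: (congr1 (fun p => 'D_(0, p) (f2 fj) (T u)) Dq).
Qed.

(** For a vertical direction the correction in [derive2_f2_transition] vanishes. *)
Lemma metric_transition u z w : W u ->
  metric fi u z w = metric fj (T u) (tr u.1 z) (tr u.1 w).
Proof.
move=> Wu; apply: etrans (metricE _ _ _ _) _; apply: etrans _ (esym (metricE _ _ _ _)).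
apply: (congr1 (fun p => 2^-1 * p)).
apply: etrans (derive2_f2_transition (0, z) w Wu) _.
have h1 : 'D_(0, z) T u = (0, tr u.1 z).
  apply: etrans ((Ttransition_diff Wu.2).2 (0, z)) _.
  apply: (congr2 pair); first exact: transfer0.
  apply: etrans (congr1 (fun p => p + _) (derive0 _ _)) _; exact: add0r.
have h2 : 'D_(0, 'D_((0 : E, z).1) (fun x => tr x w) u.1) (f2 fj) (T u) = 0.
  have := derive0 (f2 fj) (T u); apply: etrans.
  exact: (congr1 (fun p => 'D_(0, p) (f2 fj) (T u)) (derive0 _ _)).
rewrite h2 addr0.
exact: (congr1 (fun p => 'D_p (fun v => 'D_(0, tr u.1 w) (f2 fj) v) (T u)) h1).
Qed.

(** The acceleration picks up a second derivative of the transition map. The corrections to the two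
    terms of [EL] agree by symmetry of second derivatives and cancel. *)
Lemma EL_transition u z e : W u ->
  EL (f2 fi) u z e =
  EL (f2 fj) (T u) ('D_(u.2) (fun x => tr x u.2) u.1 + tr u.1 z) (tr u.1 e).
Proof.
move=> Wu; rewrite /EL.
have dj := (f2_smooth (LF j) 1%N).1 _ (Tset_transition Wu.1 Wu.2).
have h1 := derive2_f2_transition (u.2, z) e Wu.
have h2 := derive_f2_transition (e, 0) Wu.
have k1 := (Ttransition_diff Wu.2).2 (u.2, z).
have k2 := (Ttransition_diff Wu.2).2 (e, 0).
have sw : 'D_e (fun x => tr x u.2) u.1 = 'D_(u.2) (fun x => tr x e) u.1.
  apply: (Schwarz (fbasis_rV R n) _ _ _ _ (transition_smooth_overlap i j 2%N)).
    exact: overlap_open.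
  exact: Wu.2.
have k3 : ('D_((e, 0 : E).1) (fun x => tr x u.2) u.1 + tr u.1 (e, 0 : E).2) =
    'D_(u.2) (fun x => tr x e) u.1.
  by apply: etrans (congr1 (fun p => _ + p) (transfer0 _)) _; rewrite addr0.
have h3 := etrans h2 (congr1 (fun p => 'D_p (f2 fj) (T u)) (etrans k2 (congr1 (pair _) k3))).
have h4 := etrans h3 (derive_split (tr u.1 e) ('D_(u.2) (fun x => tr x e) u.1) dj).
have id1 (p q r : R) : p + q - (r + q) = p - r by ring.
apply: etrans (congr2 (fun p q => p - q) h1 h4) _.
apply: etrans (id1 _ _ _) _.
exact: (congr1 (fun p => 'D_p (fun v => 'D_(0, tr u.1 e) (f2 fj) v) (T u) - _) k1).
Qed.

End Covariance.
Local Opaque spray.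

(** * Existence of geodesics *)

Section Global.
Variables (R : realType) (n : nat) (M : manifold R n).
Local Notation E := 'rV[R]_n.
Local Notation EE := (E * E)%type.
Implicit Types (i j k : chart M) (F : TM M -> R) (D : set (TM M)) (u : EE).

Local Notation coord := Defs.coord.

Let bE : fbasis E := fbasis_rV R n.
Let bEE : fbasis EE := fbasis_prod bE bE.

Lemma slitP i u : Tset i (@slit R n M) u <-> cod i u.1 /\ u.2 != 0.
Proof.
case: u => x y; split=> -[ix /= H]; split=> //.
  by rewrite -(transfer_eq0 y (overlap_chart_at ix)).
by rewrite /slit /Tparam /= (transfer_eq0 y (overlap_chart_at ix)).
Qed.

Lemma slit_open : Topen (@slit R n M).
Proof.
move=> i; rewrite (_ : Tset i (@slit R n M) =
    (fst @^-1` cod i) `&` (snd @^-1` [set y : E | y != 0])); last first.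
  by apply/seteqP; split=> u /slitP.
apply: openI.
  apply: (@open_comp _ _ fst (cod i)) => [u _|]; first exact: cvg_fst.
  exact: cod_open.
apply: (@open_comp _ _ snd [set y : E | y != 0]) => [u _|]; first exact: cvg_snd.
rewrite (_ : [set y : E | y != 0] = ~` [set 0]).
  apply: closed_openC; apply: accessible_closed_set1.
  apply: hausdorff_accessible; exact: norm_hausdorff.
by apply/seteqP; split=> y /= /eqP.
Qed.

Lemma finsler_local D F i : D `<=` @slit R n M -> Topen D ->
  (forall p v (l : R), 0 < l -> D (p, v) -> D (p, l *: v)) ->
  finsler_conditions D F -> local_finsler (Tset i D) (local_fun F i).
Proof.
move=> Dslit oD cD [F0 sF hF ndF].
have ts x y (l : R) : cod i x -> Tparam i (x, l *: y) =
    ((Tparam i (x, y)).1, l *: (Tparam i (x, y)).2).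
  move=> ix; exact: (congr1 (pair _) (transfer_scale l y (overlap_chart_at ix))).
split.
- exact: oD.
- move=> x y l l0 [ix Dxy]; split; [exact: ix|rewrite (ts _ _ _ ix)].
  by apply: cD l0 _; rewrite -surjective_pairing; exact: Dxy.
- by move=> u [iu Du]; have /slitP[] : Tset i (@slit R n M) u by split=> //; exact: Dslit.
- exact: sF.
- move=> x y l l0 [ix Dxy]; rewrite /local_fun ts// expr1.
  have := Dxy; rewrite {1}(surjective_pairing (Tparam i (x, y))) => Dxy'.
  by rewrite (hF _ _ _ l0 Dxy') -surjective_pairing.
- by move=> u [iu Du]; exact: F0.
- by move=> u Du; exact: ndF.
Qed.

Lemma curve_velocity i j (x : R -> E) (t : R) (y : E) : is_derive t 1 x y ->
  overlap i j (x t) -> 'D_1 (coord j \o (param i \o x)) t = transfer i j (x t) y.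
Proof.
move=> [dx Dx] ij; have dx' : differentiable x t by apply/derivable1_diffP.
have := derive_comp (f := x) (g := transition i j) 1 dx' (transition_differentiable ij).
by rewrite Dx.
Qed.

Lemma is_derive_fst (u : R -> EE) (t : R) (w : EE) :
  is_derive t 1 u w -> is_derive t 1 (fun s => (u s).1) w.1.
Proof.
move=> [du Du]; have du' : differentiable u t by apply/derivable1_diffP.
have cf : continuous (@fst E E) by move=> v; exact: cvg_fst.
have lf (c : R) (v w' : EE) : (c *: v + w').1 = c *: v.1 + w'.1 by [].
apply: DeriveDef; first exact/diff_derivable/(differentiable_linear_comp lf cf du').
by rewrite -Du; exact: (derive_linear_comp (1 : R) lf cf du').
Qed.

Lemma is_derive_snd (u : R -> EE) (t : R) (w : EE) :
  is_derive t 1 u w -> is_derive t 1 (fun s => (u s).2) w.2.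
Proof.
move=> [du Du]; have du' : differentiable u t by apply/derivable1_diffP.
have cf : continuous (@snd E E) by move=> v; exact: cvg_snd.
have lf (c : R) (v w' : EE) : (c *: v + w').2 = c *: v.2 + w'.2 by [].
apply: DeriveDef; first exact/diff_derivable/(differentiable_linear_comp lf cf du').
by rewrite -Du; exact: (derive_linear_comp (1 : R) lf cf du').
Qed.

(** The spray of the chart [i] is integrated. In another chart the equation follows from [spray_EL]
    in both charts and the covariance of [EL], which replaces a transformation rule for the
    spray. *)
Lemma geodesic_exists D F i u0 :
  (forall j, local_finsler (Tset j D) (local_fun F j)) -> Tset i D u0 ->
  exists (a : R) (u : R -> EE), [/\ 0 < a, u 0 = u0,
    forall t, -a < t < a -> Tset i D (u t) /\
      is_derive t 1 u ((u t).2, - (2 *: spray (local_fun F i) (u t))) &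
    geodesic F D [set t | -a < t < a] (fun t => param i (u t).1)].
Proof.
move=> LF Du0; set f := local_fun F i; have Fi := LF i.
have oU := lf_open Fi.
pose X (u : EE) : EE := (u.2, - (2 *: spray f u)).
have sX : smooth_on (Tset i D) X.
  move=> k; apply: (Ck_coords (bW := bEE)) => // l.
  suff : Ck k (Tset i D) X by apply: Ck_coord.
  rewrite (_ : X = fun u => ((u.2, 0) : EE) + ((0, -2 *: spray f u) : EE)); last first.
    by apply/funext => u; rewrite /X scaleNr -[RHS]/(_ + _, _ + _) add0r addr0.
  apply: CkD => //.
    apply: (@Ck_linear _ EE EE _ _ (fun u => (u.2, 0))) => //.
      by move=> c v w; congr pair; rewrite /= scaler0 addr0.
    move=> v; apply: (@cvg_pair _ _ _ (nbhs v) (nbhs v.2) (nbhs (0 : E))).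
      exact: cvg_snd.
    exact: cvg_cst.
  apply: (Ck_linear_comp (l := fun y : E => (0, -2 *: y) : EE)) => //.
  - move=> c v w; congr pair; rewrite /= ?scaler0 ?addr0//.
    by rewrite scalerDr !scalerA mulrC.
  - move=> v; apply: (@cvg_pair _ _ _ (nbhs v) (nbhs (0 : E)) (nbhs (-2 *: v))).
      exact: cvg_cst.
    by apply: cvgZ; [exact: cvg_cst|exact: cvg_id].
  exact: spray_smooth.
have [a [u [a0 u0E] Hu]] := ode_exists bEE oU Du0 (sX 1%N).
exists a, u; split=> //.
pose I := [set t : R | -a < t < a].
have oI : open I.
  rewrite (_ : I = `]-a, a[%classic); first exact: interval_open.
  by apply/seteqP; split=> t; rewrite /I /= in_itv.
have su : smooth_on I u := ode_smooth bEE oI oU sX Hu.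
have sx : smooth_on I (fun t => (u t).1).
  move=> k; apply: (Ck_linear_comp (l := fun v : EE => v.1)) => // v; exact: cvg_fst.
have Dx t : I t -> is_derive t 1 (fun s => (u s).1) (u t).2.
  by move=> It; have [_ Du] := Hu t It; exact: (is_derive_fst Du).
pose c t := param i (u t).1.
have cc t : I t -> c @ t --> c t.
  move=> It; have [[iut _] _] := Hu t It.
  apply: (@continuous_comp _ _ _ (fun t => (u t).1) (param i)).
    exact: (Ck_continuous (sx 0%N) It).
  exact: param_continuous.
have oIj j : open (I `&` c @^-1` dom j).
  rewrite openE => t [It jt]; rewrite /interior.
  have n1 : nbhs t I by exact: open_nbhs_nbhs.
  have n2 : nbhs t (c @^-1` dom j).
    by apply: (cc t It); apply: open_nbhs_nbhs; split=> //; exact: dom_open.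
  by move: n1 n2; apply: filterS2 => s; split.
have over j t : (I `&` c @^-1` dom j) t -> Toverlap i j (u t).
  by move=> [It jt]; apply/overlapP; split=> //; have [[]] := Hu t It.
split.
- split=> //; last by exists 0; rewrite /= oppr_lt0 a0.
  rewrite (_ : [set _ | _] = `]-a, a[%classic); first exact: interval_is_interval.
  by apply/seteqP; split=> t; rewrite /I /= in_itv.
- split=> // j k; apply: (@Ck_comp _ _ _ _ bE bE _ _ (overlap i j)
    (fun t => (u t).1) (transition i j)) => //.
  + exact: overlap_open.
  + exact: over.
  + by apply: Ck_sub (sx k) => t [].
  + exact: transition_smooth_overlap.
- move=> t It; have [[iut Dut] _] := Hu t It.
  have E1 : velocity c t = Tparam i (u t).
    exact: (congr1 (fun v => (c t, v) : TM M)
      (curve_velocity (Dx t It) (overlap_chart_at iut))).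
  by rewrite E1.
- move=> j t It jt x.
  have ijt : Toverlap i j (u t) by exact: over.
  have [Dut [du Du]] := Hu t It.
  have D1 s : (I `&` c @^-1` dom j) s -> 'D_1 x s = transfer i j (u s).1 (u s).2.
    move=> Is; exact: (curve_velocity (Dx s Is.1) (over j s Is)).
  have du' : differentiable u t by apply/derivable1_diffP.
  have [dT DT] := Ttransfer_diff ijt.
  have D2 : 'D_1 (fun s => 'D_1 x s) t =
      'D_((u t).2) (fun z => transfer i j z (u t).2) (u t).1
      + transfer i j (u t).1 (- (2 *: spray f (u t))).
    apply: (@etrans _ _ ('D_1 (fun s => transfer i j (u s).1 (u s).2) t)).
      apply: near_eq_derive.
      have : nbhs t (I `&` c @^-1` dom j) by apply: open_nbhs_nbhs.
      by apply: filterS => s; exact: D1.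
    have H := derive_comp (g := fun v : EE => transfer i j v.1 v.2) (1 : R) du' dT.
    have H' := congr1 (fun v => 'D_v (fun v : EE => transfer i j v.1 v.2) (u t)) Du.
    exact: (etrans H (etrans H' (DT _))).
  have Tu : Tset j D (Ttransition i j (u t)) := Tset_transition Dut ijt.
  rewrite D2 D1//.
  apply: (spray_EL (LF j) _ Tu).2 => e.
  (* Every [e] in the chart [j] is the transfer of a vector in the chart [i]. *)
  have := EL_transition LF (- (2 *: spray f (u t)))
    (transfer j i (transition i j (u t).1) e) (conj Dut ijt).
  rewrite (transferVK _ ijt) => <-.
  by apply: (spray_EL Fi _ Dut).1; rewrite addNr.
Qed.

End Global.

(** * Velocity and acceleration of a reparametrized curve *)

Section Reparametrization.
Variables (R : realType) (n : nat).
Local Notation E := 'rV[R]_n.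

Lemma derive_reparam (x : R -> E) (theta : R -> R) (s : R) (y : E) :
  differentiable theta s -> is_derive (theta s) 1 x y ->
  'D_1 (x \o theta) s = 'D_1 theta s *: y.
Proof.
move=> dth [dx Dx]; have dx' : differentiable x (theta s) by apply/derivable1_diffP.
apply: etrans (derive_comp (1 : R) dth dx') _.
have h : 'D_1 theta s = 'D_1 theta s *: (1 : R) by rewrite -[RHS]/(_ * _) mulr1.
apply: etrans (congr1 (fun v => 'D_v x (theta s)) h) _.
by apply: etrans (deriveZdir ('D_1 theta s) (1 : R) dx') _; rewrite Dx.
Qed.

(** This is the origin of the acceleration s^2 z + m y in [EL_reparam]. *)
Lemma derive2_reparam (I J : set R) (x y : R -> E) (theta : R -> R) (s : R) (z : E) :
  open J -> J s -> (forall t, J t -> I (theta t)) -> smooth_on J theta ->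
  (forall t, I t -> is_derive t 1 x (y t)) -> is_derive (theta s) 1 y z ->
  'D_1 (fun t => 'D_1 (x \o theta) t) s =
  'D_1 theta s ^+ 2 *: z + 'D_1 (fun t => 'D_1 theta t) s *: y (theta s).
Proof.
move=> oJ Js JI sth dx [dy Dy].
have dth t : J t -> differentiable theta t by exact: (sth 1%N).1.
have dth2 : differentiable (fun t => 'D_1 theta t) s := ((sth 2%N).2 1).1 _ Js.
have dy' : differentiable y (theta s) by apply/derivable1_diffP.
have lS (v : E) (c a b : R) : (c *: a + b) *: v = c *: (a *: v) + b *: v.
  by rewrite scalerDl scalerA.
have cS (v : E) : continuous (fun c : R => c *: v) by exact: scalel_continuous.
have dG (v : E) := differentiable_linear_comp (lS v) (@cS v) dth2.
have DG (v : E) := derive_linear_comp (1 : R) (lS v) (@cS v) dth2.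
have dq : differentiable (fun t => y (theta t)) s.
  exact: differentiable_comp (dth _ Js) dy'.
have lG t : J t -> forall (c : R) (v v' : E), 'D_1 theta t *: (c *: v + v') =
    c *: ('D_1 theta t *: v) + 'D_1 theta t *: v'.
  by move=> _ c v v'; rewrite scalerDr !scalerA mulrC.
have [_ D] := derive_family_vec (G := fun t v => 'D_1 theta t *: v)
  (fbasis_rV R n) oJ Js dG dq lG.
apply: (@etrans _ _ ('D_1 (fun t => 'D_1 theta t *: y (theta t)) s)).
  apply: near_eq_derive; have : nbhs s J by exact: open_nbhs_nbhs.
  by apply: filterS => t Jt; exact: derive_reparam (dth _ Jt) (dx _ (JI _ Jt)).
apply: etrans (D 1) _; rewrite addrC.
have h := derive_reparam (dth _ Js) (DeriveDef dy Dy).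
apply: etrans (congr2 +%R (congr1 (fun v => 'D_1 theta s *: v) h) (DG _)) _.
by rewrite scalerA expr2.
Qed.

End Reparametrization.

Lemma geodesic_unparam (R : realType) (n : nat) (M : manifold R n)
    (F : TM M -> R) (D : set (TM M)) (I : set R) (c : R -> M) :
  geodesic F D I c -> unparam_geodesics F D (I, c).
Proof.
move=> geo; have [oI sI _ _] := geo.
have si : smooth_on I (id : R -> R) by move=> k; exact: Ck_id.
have d1 t : I t -> 0 < 'D_1 (id : R -> R) t by rewrite derive_id.
have ii : id @` I = I := image_id I.
refine (conj oI (conj sI (ex_intro _ I (ex_intro _ id _)))).
by split; [exact: oI|exact: si|exact: d1|exact: ii|exact: geo].
Qed.

(** * The golden metric *)

Section Golden.
Variables (R : realType) (n : nat) (M : manifold R n).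
Local Notation E := 'rV[R]_n.
Local Notation EE := (E * E)%type.
Local Notation slit := (@slit R n M).
Variables (F : TM M -> R) (A : pi_field M).
Hypothesis hF : finsler F.

Lemma slit_local_finsler i : local_finsler (Tset i slit) (local_fun F i).
Proof.
apply: finsler_local; [by []|exact: slit_open| |by have [] := hF].
by move=> p v l l0; rewrite /Defs.slit /= scaler_eq0 gt_eqF.
Qed.

Lemma local_field_transition i (u : EE) : cod i u.1 ->
  transfer i (chart_at (param i u.1)) u.1 (local_field A i u) = A (Tparam i u).
Proof.
by move=> iu; exact: (transferVK (A (Tparam i u)) (overlap_chart_at iu)).
Qed.

Lemma local_field_neq0 i (u : EE) : cod i u.1 -> A (Tparam i u) != 0 ->
  local_field A i u != 0.
Proof.
move=> iu; apply: contraNneq => a0.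
rewrite -(local_field_transition iu) a0.
by rewrite (transfer_eq0 0 (overlap_chart_at iu)).
Qed.

(** [Bfrak] is computed in the chart selected at the base point; covariance of the metric carries it
    to the chart [i]. *)
Lemma Bfrak_local i (u : EE) : Tset i slit u ->
  Bfrak F A (Tparam i u) = local_Bfrak (local_fun F i) (local_field A i) u.
Proof.
move=> Su; have [iu _] := Su; have iju := overlap_chart_at iu.
apply/esym; apply: etrans (metric_transition slit_local_finsler
  (local_field A i u) u.2 (conj Su iju)) _.
exact: (congr1 (fun v => metric (local_fun F (chart_at (param i u.1)))
  (Ttransition i (chart_at (param i u.1)) u) v _) (local_field_transition iu)).
Qed.

Lemma golden_localE i (u : EE) : Tset i slit u ->
  local_fun (golden F A) i u = local_golden (local_fun F i) (local_field A i) u.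
Proof.
by move=> Su; rewrite /local_fun /golden (Bfrak_local Su).
Qed.

End Golden.

Theorem theorem3p12 (R : realType) (n : nat) (hn : (2 <= n)%N)
    (M : manifold R n) (F : TM M -> R) (A : pi_field M) (D : set (TM M))
    (hF : finsler F) (hA : concurrent F A)
    (hD : conic_finsler D (golden F A))
    (hnz : forall w, D w ->
       F w ^+ 2 * (1 - 2 * Asq F A w) + 3 * Bfrak F A w ^+ 2 != 0) :
  unparam_geodesics F D <> unparam_geodesics (golden F A) D.
Proof.
move=> same.
have [[Dslit oD [[p v] Dpv] cD] Dgold] := hD.
have [sA A0 Aconc] := hA.
(* The contradiction is local, so the argument stays in one chart around a base point of [D]. *)
pose i := chart_at p; pose f := local_fun F i; pose a := local_field A i.
have Fi : local_finsler (Tset i (@slit R n M)) f := slit_local_finsler hF i.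
have DS j u : Tset j D u -> Tset j (@slit R n M) u.
  by move=> [ju Du]; split; [exact: ju|exact: Dslit].
have FD j : local_finsler (Tset j D) (local_fun F j).
  have [[F0 sF hF1 ndF] _ _ _] := hF.
  apply: (finsler_local j Dslit oD cD); split.
  - by move=> w /Dslit; exact: F0.
  - by move=> j' k; exact: (Ck_sub (DS j') (sF j' k)).
  - by move=> q v' l l0 /Dslit; exact: hF1.
  - by move=> j' u /DS; exact: ndF.
have GD : local_finsler (Tset i D) (local_fun (golden F A) i) :=
  finsler_local i Dslit oD cD Dgold.
have da u : Tset i (@slit R n M) u -> differentiable a u by exact: (sA i 1%N).1.
have ag u z : Tset i (@slit R n M) u -> berwald_gamma a u z = 0.
  by move=> Su; have [] := Aconc i u z Su.
have acg u z : Tset i (@slit R n M) u -> cartan_gamma f a u z = 0.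
  by move=> Su; have [] := Aconc i u z Su.
have acb u z : Tset i (@slit R n M) u -> cartan_beta f a u z = - z.
  by move=> Su; have [] := Aconc i u z Su.
have cod0 : cod i (Defs.coord i p) := imageP _ (chart_atP p).
pose w : 'rV[R]_n * 'rV[R]_n := (Defs.coord i p, v).
have wE : Tparam i w = (p, v).
  pose P q : TM M := (q, transfer i (chart_at q) (Defs.coord i p) v).
  apply: etrans (congr1 P (coordK (chart_atP p))) _.
  exact: (congr1 (pair p) (transfer_refl v cod0)).
have Uw : Tset i D w by split; [exact: cod0|rewrite wE; exact: Dpv].
have a0 : a w != 0.
  by apply: (local_field_neq0 (u := w) cod0); rewrite wE; exact/A0/Dslit.
(* It remains to obtain F^2 A = Bfrak y at every vector of [D] over this chart. *)
refine (not_radial Fi da ag acg hn (lf_open GD) (DS i) Uw a0 _) => u0 Du0.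
have [b [u [b0 u0E Hu geo]]] := geodesic_exists FD Du0.
pose I := [set t : R | -b < t < b]; pose c t := param i (u t).1.
have : unparam_geodesics F D (I, c) := geodesic_unparam geo.
(* The same curve is a golden geodesic after a change of parameter [theta]. It is examined at the
   parameter [s] that [theta] sends to 0, where the original velocity is [u0]. *)
rewrite same => -[_ [_ [I' [theta [[oI' _ _] sth th0 thI [_ _ _ gg]]]]]].
have I0 : I 0 by rewrite /I /= oppr_lt0 b0.
have [s I's ths] : exists2 s, I' s & theta s = 0.
  by have : I 0 := I0; rewrite -[I]thI => -[s]; exists s.
have JI t : I' t -> I (theta t) by move=> I't; rewrite -[I]thI; exists t.
have Dx t : I t -> is_derive t 1 (fun s => (u s).1) (u t).2.
  by move=> /Hu[_ /is_derive_fst].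
have codI t : I t -> cod i (u t).1 by move=> /Hu[[]].
have ci t : I t -> Defs.coord i (c t) = (u t).1 by move=> /codI/cod_param[].
have domc t : I t -> dom i (c t) by move=> /codI/cod_param[].
have dsnd : is_derive (theta s) 1 (fun t => (u t).2) (- (2 *: spray f u0)).
  by have [_ /is_derive_snd] := Hu _ (JI _ I's); rewrite ths u0E.
have oI : open I by have [[]] := geo.
have xc t : I' t -> (Defs.coord i \o (c \o theta)) t = ((fun t => (u t).1) \o theta) t.
  by move=> /JI /ci.
have nb t : I' t -> nbhs t I'.
  by move=> I't; apply: open_nbhs_nbhs; split; [exact: oI'|exact: I't].
have nI' t : I' t -> \forall t' \near t,
    (Defs.coord i \o (c \o theta)) t' = ((fun t => (u t).1) \o theta) t'.
  by move=> /nb; exact: (filterS xc).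
have dth t : I' t -> differentiable theta t by exact: (sth 1%N).1.
set sg := 'D_1 theta s; set mu := 'D_1 (fun t => 'D_1 theta t) s.
have D1 : 'D_1 (Defs.coord i \o (c \o theta)) s = sg *: u0.2.
  apply: etrans (near_eq_derive _ (nI' _ I's)) _.
  apply: etrans (derive_reparam (dth _ I's) (Dx _ (JI _ I's))) _.
  by rewrite ths u0E.
have D2 : 'D_1 (fun t => 'D_1 (Defs.coord i \o (c \o theta)) t) s =
    sg ^+ 2 *: (- (2 *: spray f u0)) + mu *: u0.2.
  apply: (@etrans _ _ ('D_1 (fun t => 'D_1 ((fun t => (u t).1) \o theta) t) s)).
    apply: near_eq_derive; apply: filterS (nb _ I's) => t I't.
    exact: near_eq_derive (nI' _ I't).
  apply: etrans (derive2_reparam oI' I's JI sth Dx dsnd) _.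
  by rewrite ths u0E.
have sg0 : 0 < sg by exact: th0.
have xs : (Defs.coord i \o (c \o theta)) s = u0.1.
  by apply: etrans (xc _ I's) _; rewrite /= ths u0E.
set z := - (2 *: spray f u0) in D2.
set g := local_fun (golden F A) i.
(* The golden geodesic equation at the rescaled velocity, with the acceleration of the
   reparametrized curve. *)
have geo' : sg ^+ 2 *: z + mu *: u0.2 + 2 *: spray g (u0.1, sg *: u0.2) = 0.
  apply: etrans _ (gg i s I's (domc _ (JI _ I's))).
  exact: (congr2 (fun p q => p + 2 *: spray g q) (esym D2)
    (congr2 pair (esym xs) (esym D1))).
have Du0' : Tset i D (u0.1, u0.2) by rewrite -surjective_pairing.
have Dsu : Tset i D (u0.1, sg *: u0.2) := lf_conic GD sg0 Du0'.
(* [EL_energy] passes from the square of the golden metric to the metric itself, which is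
   1-homogeneous, so that [EL_reparam] removes [sg] and [mu]. *)
have ELg e : EL g (u0.1, u0.2) z e = 0.
  have h1 := (EL_energy GD Dsu ((spray_EL GD _ Dsu).1 geo')).2 e.
  have h2 := EL_reparam z e mu (lf_open GD) (lf_conic GD) (lf_homogeneous GD)
    (lf_smooth GD) sg0 Du0'.
  have /eqP := etrans (esym h2) h1.
  by rewrite mulf_eq0 (gt_eqF sg0) /= => /eqP.
rewrite -surjective_pairing in ELg.
apply: (golden_geodesic_radial Fi da ag acg acb (DS i _ Du0) (z := z)).
  exact: addNr.
move=> e; apply: etrans _ (ELg e).
apply: (EL_eq _ _ (lf_open GD) Du0) => u' Du'; apply/esym.
exact: (golden_localE A hF (DS i _ Du')).
Qed.
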